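(* In the setting described in the context, with all standing assumptions in force, let $\{(\mathbf x_{(i,:)}^t)_{i=1}^N\}_{t\ge0}$ be generated by the block-wise algorithm. Then: (i) (consensus) $\lim_{t\to\infty}\|\mathbf x_{(i,:)}^t-\bar{\mathbf s}^t\|=0$ for every $i\in\{1,\dots,N\}$; (ii) (convergence) the sequence $\{\bar{\mathbf s}^t\}_{t\ge0}$ is bounded, and every limit point of it is a stationary solution of problem (P).
   Context: Problem. Let $N,B,d\ge1$. A vector $\mathbf x\in\mathbb R^{dB}$ is partitioned into blocks $\mathbf x=(\mathbf x_1,\dots,\mathbf x_B)$ with $\mathbf x_\ell\in\mathbb R^d$, and $\nabla_\ell$ denotes the partial gradient with respect to block $\ell$. Problem (P) is $$\min_{\mathbf x}\ U(\mathbf x)=\sum_{i=1}^Nf_i(\mathbf x)+\sum_{\ell=1}^B r_\ell(\mathbf x_\ell)\quad\text{s.t. }\mathbf x_\ell\in\mathcal K_\ell,\ \ell=1,\dots,B,$$ with $\mathcal K=\mathcal K_1\times\dots\times\mathcal K_B$. Problem assumptions: - each $\mathcal K_\ell\subseteq\mathbb R^d$ is nonempty, closed and convex; - each $f_i:\mathbb R^{dB}\to\mathbb R$ is $C^1$ on an open set containing $\mathcal K$, and $\nabla f_i$ is $L_i$-Lipschitz continuous and bounded on $\mathcal K$; - each $r_\ell:\mathbb R^d\to\mathbb R$ is convex with bounded subgradients on $\mathcal K_\ell$; - $U$ is coercive on $\mathcal K$. A point $\mathbf x^*\in\mathcal K$ is a stationary solution of (P) if $$\sum_{\ell=1}^B\Big[\big(\textstyle\sum_i\nabla_\ell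 f_i(\mathbf x^* )\big)^\top(\mathbf x_\ell-\mathbf x^*_\ell)+r_\ell(\mathbf x_\ell)-r_\ell(\mathbf x^*_\ell)\Big]\ge0\quad\text{for all }\mathbf x\in\mathcal K.$$ Network. $\mathcal G=(\{1,\dots,N\},\mathcal E)$ is a fixed, strongly connected digraph containing all self-loops. The in-neighbor set of $i$ is $\mathcal N_i=\{j:(j,i)\in\mathcal E\}$. Block selection. At each iteration $t\ge0$, agent $i$ picks $\ell_i^t\in\{1,\dots,B\}$. For each $i$ there is a finite $T_i>0$ with $\bigcup_{\tau=0}^{T_i-1}\{\ell_i^{t+\tau}\}=\{1,\dots,B\}$ for all $t\ge0$. Define $\mathcal N_{i,\ell}^t=\{j\in\mathcal N_i:\ell_j^t=\ell\}\cup\{i\}$ and $\mathcal E_\ell^t=\{(j,i)\in\mathcal E:j\in\mathcal N_{i,\ell}^t\}$. Weights. For each $\ell$ and $t$, $A_\ell^t=[a_{ij\ell}^t]$ satisfies $a_{ij\ell}^t>\kappa$ if $(j,i)\in\mathcal E_\ell^t$, $a_{ij\ell}^t=0$ otherwise (for a fixed $\kappa>0$), and $\mathbf 1^\top A_\ell^t=\mathbf 1^\top$. Surrogates. For each $i,\ell$, $\tilde f_{i,\ell}:\mathcal K_\ell\times\mathcal K\to\mathbb R$ satisfies: - $\tilde f_{i,\ell}(\cdot;\mathbf x)$ is $C^1$ and $\tau_i$-strongly convex on $\mathcal K_\ell$ uniformly in $\mathbf x\in\mathcal K$, with $\tau_i>0$; - $\nabla\tilde f_{i,\ell}(\mathbf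 x_\ell;\mathbf x)=\nabla_\ell f_i(\mathbf x)$ for all $\mathbf x\in\mathcal K$, where $\nabla\tilde f_{i,\ell}$ is the gradient in the first argument and $\mathbf x_\ell$ is the $\ell$-th block of $\mathbf x$; - $\nabla\tilde f_{i,\ell}(\mathbf z;\cdot)$ is Lipschitz continuous on $\mathcal K$ uniformly in $\mathbf z\in\mathcal K_\ell$. For $\mathbf w\in\mathcal K$ and $\mathbf g\in\mathbb R^d$ let $$\hat f_{i,\ell}(\mathbf z;\mathbf w,\mathbf g)=\tilde f_{i,\ell}(\mathbf z;\mathbf w)+(N\mathbf g-\nabla_\ell f_i(\mathbf w))^\top(\mathbf z-\mathbf w_\ell).$$ Step sizes. $0<\gamma^t\le1$, $\gamma^{t+1}\le\gamma^t$, $\sum_t\gamma^t=\infty$, $\sum_t(\gamma^t)^2<\infty$. Algorithm. Agent $i$ holds $\mathbf x_{(i,:)}^t=(\mathbf x_{(i,\ell)}^t)_\ell$, $\mathbf y_{(i,:)}^t=(\mathbf y_{(i,\ell)}^t)_\ell$ in $\mathbb R^{dB}$ and scalars $\phi_{(i,\ell)}^t$. Initialization: $\mathbf x_{(i,:)}^0\in\mathcal K$ arbitrary, $\mathbf y_{(i,:)}^0=\nabla f_i(\mathbf x_{(i,:)}^0)$, $\phi_{(i,\ell)}^0=1$. At iteration $t$, each agent $i$: - computes $\tilde{\mathbf x}_{(i,\ell_i^t)}^t=\arg\min_{\mathbf z\in\mathcal K_{\ell_i^t}}\hat f_{i,\ell_i^t}(\mathbf z;\mathbf x_{(i,:)}^t,\mathbf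 y_{(i,\ell_i^t)}^t)+r_{\ell_i^t}(\mathbf z)$; - sets $\Delta\mathbf x_{(i,\ell)}^t=\tilde{\mathbf x}_{(i,\ell)}^t-\mathbf x_{(i,\ell)}^t$ if $\ell=\ell_i^t$ and $\Delta\mathbf x_{(i,\ell)}^t=\mathbf 0$ otherwise; - for every $\ell$ updates $$\phi_{(i,\ell)}^{t+1}=\sum_{j\in\mathcal N_{i,\ell}^t}a_{ij\ell}^t\phi_{(j,\ell)}^t,\qquad \mathbf x_{(i,\ell)}^{t+1}=\sum_{j\in\mathcal N_{i,\ell}^t}\frac{a_{ij\ell}^t\phi_{(j,\ell)}^t}{\phi_{(i,\ell)}^{t+1}}\big(\mathbf x_{(j,\ell)}^t+\gamma^t\Delta\mathbf x_{(j,\ell)}^t\big),$$ $$\mathbf y_{(i,\ell)}^{t+1}=\sum_{j\in\mathcal N_{i,\ell}^t}\frac{a_{ij\ell}^t}{\phi_{(i,\ell)}^{t+1}}\Big(\phi_{(j,\ell)}^t\mathbf y_{(j,\ell)}^t+\nabla_\ell f_j(\mathbf x_{(j,:)}^{t+1})-\nabla_\ell f_j(\mathbf x_{(j,:)}^t)\Big).$$ Weighted average: $\bar{\mathbf s}^t=\frac1N\big(\sum_{i=1}^N\phi_{(i,\ell)}^t\mathbf x_{(i,\ell)}^t\big)_{\ell=1}^B$. *)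

(* Defs.v *)
From Stdlib Require Import Reals Lra Lia.
From Stdlib Require Import Relations.Relation_Operators.
Open Scope R_scope.

(* Conventions.  A vector of R^d is a function nat -> R of which only the
   coordinates k < d are meaningful.  A vector of R^{dB} is a function
   nat -> (nat -> R): block l (l < B), coordinate k (k < d).
   Agents are indexed 0..N-1, blocks 0..B-1. *)
Definition vec := nat -> R.
Definition bvec := nat -> vec.

Fixpoint rsum (n : nat) (f : nat -> R) : R :=
  match n with O => 0 | S m => rsum m f + f m end.

Definition ipv (d : nat) (u v : vec) : R := rsum d (fun k => u k * v k).
Definition normv (d : nat) (u : vec) : R := sqrt (ipv d u u).
Definition ipb (d B : nat) (x y : bvec) : R := rsum B (fun l => ipv d (x l) (y l)).
Definition normb (d B : nat) (x : bvec) : R := sqrt (ipb d B x x).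

Definition vadd (u v : vec) : vec := fun k => u k + v k.
Definition vsub (u v : vec) : vec := fun k => u k - v k.
Definition vscal (a : R) (u : vec) : vec := fun k => a * u k.
Definition vzero : vec := fun _ => 0.
Definition badd (x y : bvec) : bvec := fun l k => x l k + y l k.
Definition bsub (x y : bvec) : bvec := fun l k => x l k - y l k.

Definition eqv (d : nat) (u v : vec) : Prop := forall k, (k < d)%nat -> u k = v k.
Definition eqbv (d B : nat) (x y : bvec) : Prop :=
  forall l, (l < B)%nat -> eqv d (x l) (y l).

Definition inK (B : nat) (K : nat -> vec -> Prop) (x : bvec) : Prop :=
  forall l, (l < B)%nat -> K l (x l).

Definition closed_vset (d : nat) (S : vec -> Prop) : Prop :=
  forall z, (forall eps, 0 < eps -> exists w, S w /\ normv d (vsub w z) < eps) -> S z.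
Definition convex_vset (S : vec -> Prop) : Prop :=
  forall u v th, S u -> S v -> 0 <= th <= 1 -> S (vadd (vscal th u) (vscal (1 - th) v)).
Definition open_bset (d B : nat) (U : bvec -> Prop) : Prop :=
  forall x, U x -> exists eps, 0 < eps /\
    forall y, normb d B (bsub y x) < eps -> U y.

Definition has_grad_b (d B : nat) (f : bvec -> R) (g x : bvec) : Prop :=
  forall eps, 0 < eps -> exists del, 0 < del /\
    forall h, normb d B h < del ->
      Rabs (f (badd x h) - f x - ipb d B g h) <= eps * normb d B h.
Definition has_grad_v (d : nat) (f : vec -> R) (g z : vec) : Prop :=
  forall eps, 0 < eps -> exists del, 0 < del /\
    forall h, normv d h < del ->
      Rabs (f (vadd z h) - f z - ipv d g h) <= eps * normv d h.

Definition cont_on_b (d B : nat) (U : bvec -> Prop) (G : bvec -> bvec) : Prop :=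
  forall x, U x -> forall eps, 0 < eps -> exists del, 0 < del /\
    forall y, U y -> normb d B (bsub y x) < del -> normb d B (bsub (G y) (G x)) < eps.
Definition cont_on_v (d : nat) (S : vec -> Prop) (G : vec -> vec) : Prop :=
  forall z, S z -> forall eps, 0 < eps -> exists del, 0 < del /\
    forall w, S w -> normv d (vsub w z) < del -> normv d (vsub (G w) (G z)) < eps.

Definition C1_on_nbhd (d B : nat) (S : bvec -> Prop) (f : bvec -> R) (G : bvec -> bvec) : Prop :=
  exists U, open_bset d B U /\ (forall x, S x -> U x) /\
    (forall x, U x -> has_grad_b d B f (G x) x) /\ cont_on_b d B U G.

Definition lipschitz_on_b (d B : nat) (S : bvec -> Prop) (G : bvec -> bvec) (L : R) : Prop :=
  forall x y, S x -> S y -> normb d B (bsub (G x) (G y)) <= L * normb d B (bsub x y).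
Definition bounded_on_b (d B : nat) (S : bvec -> Prop) (G : bvec -> bvec) : Prop :=
  exists M, forall x, S x -> normb d B (G x) <= M.

Definition convex_fun (r : vec -> R) : Prop :=
  forall u v th, 0 <= th <= 1 ->
    r (vadd (vscal th u) (vscal (1 - th) v)) <= th * r u + (1 - th) * r v.
Definition is_subgrad (d : nat) (r : vec -> R) (z g : vec) : Prop :=
  forall w, r z + ipv d g (vsub w z) <= r w.
Definition bounded_subgrad_on (d : nat) (S : vec -> Prop) (r : vec -> R) : Prop :=
  exists M, forall z g, S z -> is_subgrad d r z g -> normv d g <= M.

Definition strongly_convex_on (d : nat) (S : vec -> Prop) (f : vec -> R) (tau : R) : Prop :=
  forall u v th, S u -> S v -> 0 <= th <= 1 ->
    f (vadd (vscal th u) (vscal (1 - th) v))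
      <= th * f u + (1 - th) * f v - tau / 2 * th * (1 - th) * (normv d (vsub u v))^2.

Definition coercive_on (d B : nat) (S : bvec -> Prop) (U : bvec -> R) : Prop :=
  forall M, exists Rr, forall x, S x -> Rr <= normb d B x -> M <= U x.

Definition Uobj (N B : nat) (f : nat -> bvec -> R) (r : nat -> vec -> R) (x : bvec) : R :=
  rsum N (fun i => f i x) + rsum B (fun l => r l (x l)).

Definition stationary (N d B : nat) (K : nat -> vec -> Prop) (gf : nat -> bvec -> bvec)
  (r : nat -> vec -> R) (xs : bvec) : Prop :=
  inK B K xs /\
  forall x, inK B K x ->
    0 <= rsum B (fun l =>
           ipv d (fun k => rsum N (fun i => gf i xs l k)) (vsub (x l) (xs l))
           + r l (x l) - r l (xs l)).

Definition strongly_connected (N : nat) (E : nat -> nat -> Prop) : Prop :=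
  forall i j, (i < N)%nat -> (j < N)%nat ->
    clos_trans nat (fun a b => (a < N)%nat /\ (b < N)%nat /\ E a b) i j.

Definition in_Nil (N : nat) (E : nat -> nat -> Prop) (sel : nat -> nat -> nat)
  (t i l j : nat) : Prop :=
  ((j < N)%nat /\ E j i /\ sel t j = l) \/ j = i.

Definition in_Elt (N : nat) (E : nat -> nat -> Prop) (sel : nat -> nat -> nat)
  (t i l j : nat) : Prop := E j i /\ in_Nil N E sel t i l j.

Definition hatf (N d : nat) (tf : vec -> bvec -> R) (gfi : bvec -> bvec) (l : nat)
  (z : vec) (w : bvec) (g : vec) : R :=
  tf z w + ipv d (vsub (vscal (INR N) g) (gfi w l)) (vsub z (w l)).

Definition dx (x : nat -> nat -> bvec) (xt : nat -> nat -> vec) (sel : nat -> nat -> nat)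
  (t j l : nat) : vec :=
  if Nat.eqb (sel t j) l then vsub (xt t j) (x t j l) else vzero.

Definition sbar (N : nat) (phi : nat -> nat -> nat -> R) (x : nat -> nat -> bvec) (t : nat) : bvec :=
  fun l k => / INR N * rsum N (fun i => phi t i l * x t i l k).

Definition limit_point (d B : nat) (s : nat -> bvec) (xs : bvec) : Prop :=
  forall eps, 0 < eps -> forall T, exists t, (T <= t)%nat /\ normb d B (bsub (s t) xs) < eps.

(* Main.v *)
(**
  Weighting the push-sum recursions by [phi] turns them into averaging recursions
  [z(t+1) = W(t) (z(t) + p(t))] with row-stochastic [W(t)], whose positive entries are bounded
  below because [phi] is. Within a fixed number of iterations every agent influences every other
  one, so the spread max - min of [z] contracts up to the size of [p], and square summable
  perturbations give square summable spreads. Bounded gradients make [y] bounded, hence the steps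
  [dx] are bounded and the perturbation of [x] is of order [gamma]; then the spread of [x] and, by
  Lipschitz continuity of the gradients, that of [y] are square summable.

  The weighted average satisfies
  [s(t+1) = (1 - gamma) s(t) + gamma * sum_j (phi_j / N) Xt_j], so convexity of [r] and strong
  convexity of the surrogates give a descent inequality for [U(s(t))] with summable error. By
  coercivity [s] is bounded, and [gamma * |dx|^2] is summable. Near a point that violates the
  stationarity condition in block [l], the step of an agent that selects [l] is bounded away from
  0; as each block is selected in every window of fixed length, a late visit to a small ball around
  such a point would trap [s] there and make [gamma] summable.
*)

Require Import Defs.
From Stdlib Require Import Reals Lra Lia.
From Stdlib Require Import Relations.Relation_Operators.
Open Scope R_scope.

(** What holds the estimates together is square summability: [gamma], [ex] and [ey] are each square
    summable, so every error in the descent inequality, a product of [gamma] with one of them, is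
    summable, although [ex] and [ey] themselves need not be. The estimates for [x] and [y] look
    circular, as a step depends on [y], and [y] on the increments of gradients caused by the steps.
    The circle is broken by bounding those increments by twice the gradient bound, whatever the
    steps are; Lipschitz continuity is used only afterwards. A bound on the subgradients of [r] says
    something only once subgradients are known to exist, hence a finite-dimensional Hahn-Banach
    construction. At the end, an agent moves one block per iteration, so the decrease is collected
    over windows of [T] iterations; monotonicity of [gamma] allows a whole window to be weighted by
    the step size at its end. *)

(** * Finite sums *)

Lemma rsum_ext n f g : (forall k, (k < n)%nat -> f k = g k) -> rsum n f = rsum n g.
Proof.
  induction n as [|n IH]; intros H; simpl; [reflexivity|].
  rewrite IH, (H n); [reflexivity | lia | intros; apply H; lia].
Qed.

Lemma rsum_S n f : rsum (S n) f = rsum n f + f n.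
Proof. reflexivity. Qed.

Lemma rsum_plus n f g : rsum n (fun k => f k + g k) = rsum n f + rsum n g.
Proof. induction n as [|n IH]; simpl; [lra | rewrite IH; lra]. Qed.

Lemma rsum_minus n f g : rsum n (fun k => f k - g k) = rsum n f - rsum n g.
Proof. induction n as [|n IH]; simpl; [lra | rewrite IH; lra]. Qed.

Lemma rsum_scal n a f : rsum n (fun k => a * f k) = a * rsum n f.
Proof. induction n as [|n IH]; simpl; [lra | rewrite IH; lra]. Qed.

Lemma rsum_scal_r n a f : rsum n (fun k => f k * a) = rsum n f * a.
Proof. induction n as [|n IH]; simpl; [lra | rewrite IH; lra]. Qed.

Lemma rsum_const n a : rsum n (fun _ => a) = INR n * a.
Proof. induction n as [|n IH]; [simpl; lra | simpl rsum; rewrite IH, S_INR; lra]. Qed.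

Lemma rsum_zero n f : (forall k, (k < n)%nat -> f k = 0) -> rsum n f = 0.
Proof. intros H. rewrite (rsum_ext n f (fun _ => 0) H), rsum_const. lra. Qed.

Lemma rsum_le n f g : (forall k, (k < n)%nat -> f k <= g k) -> rsum n f <= rsum n g.
Proof.
  induction n as [|n IH]; intros H; simpl; [lra|].
  assert (rsum n f <= rsum n g) by (apply IH; intros; apply H; lia).
  pose proof (H n ltac:(lia)). lra.
Qed.

Lemma rsum_nonneg n f : (forall k, (k < n)%nat -> 0 <= f k) -> 0 <= rsum n f.
Proof.
  intros H. rewrite <- (rsum_zero n (fun _ => 0)) by reflexivity. now apply rsum_le.
Qed.

Lemma rsum_abs n f : Rabs (rsum n f) <= rsum n (fun k => Rabs (f k)).
Proof.
  induction n as [|n IH]; simpl; [rewrite Rabs_R0; lra|].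
  eapply Rle_trans; [apply Rabs_triang | lra].
Qed.

Lemma rsum_swap n m (f : nat -> nat -> R) :
  rsum n (fun i => rsum m (fun j => f i j)) = rsum m (fun j => rsum n (fun i => f i j)).
Proof.
  induction n as [|n IH]; simpl; [symmetry; now apply rsum_zero|].
  now rewrite IH, <- rsum_plus.
Qed.

Lemma rsum_term_le n f i :
  (forall k, (k < n)%nat -> 0 <= f k) -> (i < n)%nat -> f i <= rsum n f.
Proof.
  induction n as [|n IH]; intros H Hi; [lia|]; simpl.
  destruct (Nat.eq_dec i n) as [->|Hne].
  - assert (0 <= rsum n f) by (apply rsum_nonneg; intros; apply H; lia). lra.
  - assert (f i <= rsum n f) by (apply IH; [intros; apply H|]; lia).
    pose proof (H n ltac:(lia)). lra.
Qed.

Lemma rsum_add_nat n m f : rsum (n + m) f = rsum n f + rsum m (fun k => f (n + k)%nat).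
Proof.
  induction m as [|m IH]; [rewrite Nat.add_0_r; simpl; lra|].
  rewrite Nat.add_succ_r. simpl. rewrite IH. lra.
Qed.

Lemma rsum_le_length n m f :
  (forall k, 0 <= f k) -> (n <= m)%nat -> rsum n f <= rsum m f.
Proof.
  intros H Hnm. replace m with (n + (m - n))%nat by lia. rewrite rsum_add_nat.
  pose proof (rsum_nonneg (m - n) (fun k => f (n + k)%nat) ltac:(intros; apply H)). lra.
Qed.

Lemma rsum_sum_f_R0 n f : rsum (S n) f = sum_f_R0 f n.
Proof. induction n as [|n IH]; [simpl; lra|]. simpl in *. now rewrite IH. Qed.

(** * Euclidean norms *)

Lemma ipv_sym d u v : ipv d u v = ipv d v u.
Proof. apply rsum_ext; intros; ring. Qed.

Lemma ipv_ext d u u' v v' : eqv d u u' -> eqv d v v' -> ipv d u v = ipv d u' v'.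
Proof. intros Hu Hv. apply rsum_ext; intros k Hk. now rewrite (Hu k Hk), (Hv k Hk). Qed.

Lemma ipv_scal_r d a u v : ipv d u (vscal a v) = a * ipv d u v.
Proof. unfold ipv, vscal. rewrite <- rsum_scal. apply rsum_ext; intros; ring. Qed.

Lemma ipv_add_r d u v w : ipv d u (vadd v w) = ipv d u v + ipv d u w.
Proof. unfold ipv, vadd. rewrite <- rsum_plus. apply rsum_ext; intros; ring. Qed.

Lemma ipv_sub_r d u v w : ipv d u (vsub v w) = ipv d u v - ipv d u w.
Proof. unfold ipv, vsub. rewrite <- rsum_minus. apply rsum_ext; intros; ring. Qed.

Lemma ipv_sub_l d u v w : ipv d (vsub v w) u = ipv d v u - ipv d w u.
Proof. unfold ipv, vsub. rewrite <- rsum_minus. apply rsum_ext; intros; ring. Qed.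

Lemma ipv_add_l d u v w : ipv d (vadd v w) u = ipv d v u + ipv d w u.
Proof. unfold ipv, vadd. rewrite <- rsum_plus. apply rsum_ext; intros; ring. Qed.

Lemma ipv_rsum_l d n (f : nat -> vec) v :
  ipv d (fun k => rsum n (fun i => f i k)) v = rsum n (fun i => ipv d (f i) v).
Proof.
  unfold ipv. rewrite rsum_swap. apply rsum_ext; intros. now rewrite <- rsum_scal_r.
Qed.

Lemma ipv_rsum_r d n (f : nat -> vec) v :
  ipv d v (fun k => rsum n (fun i => f i k)) = rsum n (fun i => ipv d v (f i)).
Proof.
  rewrite ipv_sym, ipv_rsum_l. apply rsum_ext; intros; apply ipv_sym.
Qed.

Lemma ipv_self_nonneg d u : 0 <= ipv d u u.
Proof. apply rsum_nonneg; intros; nra. Qed.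

(** Induction on the dimension: a new pair of coordinates [a], [b] requires
    [2 S a b <= P b^2 + Q a^2], which follows from [S^2 <= P Q] and the inequality between
    arithmetic and geometric means. *)
Lemma ipv_CS_sqr d u v : (ipv d u v)^2 <= ipv d u u * ipv d v v.
Proof.
  induction d as [|d IH]; unfold ipv in *; simpl rsum; [simpl; lra|].
  pose proof (ipv_self_nonneg d u) as HA. pose proof (ipv_self_nonneg d v) as HC.
  unfold ipv in HA, HC.
  set (S := rsum d (fun k => u k * v k)) in *.
  set (P := rsum d (fun k => u k * u k)) in *.
  set (Q := rsum d (fun k => v k * v k)) in *.
  generalize (u d) (v d); intros a b.
  assert (H : 2 * S * (a * b) <= P * (b * b) + Q * (a * a)).
  { apply Rle_trans with (Rabs (2 * S * (a * b))); [apply Rle_abs|].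
    apply Rsqr_incr_0_var; [|nra].
    rewrite <- Rsqr_abs. unfold Rsqr.
    apply Rle_trans with (4 * (P * Q) * (a * b) ^ 2);
      [|pose proof (pow2_ge_0 (P * (b * b) - Q * (a * a))); nra].
    pose proof (pow2_ge_0 (a * b)). nra. }
  nra.
Qed.

Lemma normv_nonneg d u : 0 <= normv d u.
Proof. apply sqrt_pos. Qed.

Lemma normv_sqr d u : normv d u ^ 2 = ipv d u u.
Proof. unfold normv. rewrite pow2_sqrt; [reflexivity | apply ipv_self_nonneg]. Qed.

Lemma normv_ext d u v : eqv d u v -> normv d u = normv d v.
Proof. intros H. unfold normv. now rewrite (ipv_ext d u v u v). Qed.

Lemma ipv_CS_abs d u v : Rabs (ipv d u v) <= normv d u * normv d v.
Proof.
  pose proof (normv_nonneg d u). pose proof (normv_nonneg d v).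
  apply Rsqr_incr_0_var; [|nra].
  rewrite <- Rsqr_abs. pose proof (ipv_CS_sqr d u v).
  rewrite <- 2!normv_sqr in H1. unfold Rsqr. nra.
Qed.

Lemma ipv_CS d u v : ipv d u v <= normv d u * normv d v.
Proof. eapply Rle_trans; [apply Rle_abs | apply ipv_CS_abs]. Qed.

Lemma normv_scal d a u : normv d (vscal a u) = Rabs a * normv d u.
Proof.
  unfold normv. replace (ipv d (vscal a u) (vscal a u)) with (a^2 * ipv d u u).
  - rewrite sqrt_mult; [|nra | apply ipv_self_nonneg].
    now rewrite <- (sqrt_Rsqr_abs a), Rsqr_pow2.
  - unfold ipv, vscal. rewrite <- rsum_scal. apply rsum_ext; intros; ring.
Qed.

Lemma normv_triang d u v : normv d (vadd u v) <= normv d u + normv d v.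
Proof.
  pose proof (normv_nonneg d u). pose proof (normv_nonneg d v).
  apply Rsqr_incr_0_var; [|lra]. rewrite !Rsqr_pow2, normv_sqr.
  rewrite ipv_add_r, !ipv_add_l, (ipv_sym d v u).
  pose proof (ipv_CS d u v). rewrite <- !normv_sqr. nra.
Qed.

Lemma normv_vzero d : normv d vzero = 0.
Proof.
  unfold normv. replace (ipv d vzero vzero) with 0; [apply sqrt_0|].
  symmetry. apply rsum_zero; intros; unfold vzero; ring.
Qed.

Lemma normv_sub_sym d u v : normv d (vsub u v) = normv d (vsub v u).
Proof.
  transitivity (normv d (vscal (-1) (vsub v u))).
  - apply normv_ext; intros k _; unfold vscal, vsub; ring.
  - rewrite normv_scal, Rabs_left by lra. lra.
Qed.

Lemma normv_sub_triang d u v w :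
  normv d (vsub u w) <= normv d (vsub u v) + normv d (vsub v w).
Proof.
  eapply Rle_trans; [|apply normv_triang]. right.
  apply normv_ext; intros k _; unfold vadd, vsub; ring.
Qed.

Lemma normv_coord d u k : (k < d)%nat -> Rabs (u k) <= normv d u.
Proof.
  intros Hk. apply Rsqr_incr_0_var; [|apply normv_nonneg].
  rewrite <- Rsqr_abs, (Rsqr_pow2 (normv d u)), normv_sqr. unfold Rsqr.
  apply (rsum_term_le d (fun k => u k * u k)); [intros; nra | exact Hk].
Qed.

Lemma normv_le_sum d u : normv d u <= rsum d (fun k => Rabs (u k)).
Proof.
  assert (Hs : forall n, 0 <= rsum n (fun k => Rabs (u k)))
    by (intros; apply rsum_nonneg; intros; apply Rabs_pos).
  apply Rsqr_incr_0_var; [|apply Hs].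
  rewrite Rsqr_pow2, normv_sqr. unfold ipv, Rsqr.
  induction d as [|d IH]; simpl; [lra|].
  pose proof (Hs d). pose proof (Rabs_pos (u d)).
  assert (u d * u d = Rabs (u d) * Rabs (u d))
    by (pose proof (Rsqr_abs (u d)); unfold Rsqr in *; lra).
  nra.
Qed.

(** Seeing a block norm as the norm of the vector of block norms reduces the block inequalities
    below to those for [normv]. *)
Lemma normb_normv d B x : normb d B x = normv B (fun l => normv d (x l)).
Proof.
  unfold normb, ipb. unfold normv at 1. f_equal. apply rsum_ext; intros l _.
  rewrite <- normv_sqr. ring.
Qed.

Lemma normb_nonneg d B x : 0 <= normb d B x.
Proof. apply sqrt_pos. Qed.

Lemma normb_ext d B x y : eqbv d B x y -> normb d B x = normb d B y.
Proof.
  intros H. rewrite !normb_normv. apply normv_ext; intros l Hl. now apply normv_ext, H.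
Qed.

Lemma normv_mono d u v :
  (forall k, (k < d)%nat -> 0 <= u k <= v k) -> normv d u <= normv d v.
Proof.
  intros H. apply sqrt_le_1_alt, rsum_le; intros k Hk. specialize (H k Hk). nra.
Qed.

Lemma ipb_CS_abs d B x y : Rabs (ipb d B x y) <= normb d B x * normb d B y.
Proof.
  rewrite !normb_normv. eapply Rle_trans; [apply rsum_abs|].
  eapply Rle_trans; [|apply ipv_CS].
  apply rsum_le; intros; apply ipv_CS_abs.
Qed.

Lemma normb_block d B x l : (l < B)%nat -> normv d (x l) <= normb d B x.
Proof.
  intros Hl. rewrite normb_normv.
  eapply Rle_trans; [apply Rle_abs | exact (normv_coord B (fun l => normv d (x l)) l Hl)].
Qed.

Lemma normb_scal d B a x : normb d B (fun l k => a * x l k) = Rabs a * normb d B x.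
Proof.
  rewrite !normb_normv, <- (Rabs_Rabsolu a), <- normv_scal.
  apply normv_ext; intros l _. unfold vscal at 1.
  rewrite <- normv_scal. reflexivity.
Qed.

Lemma normb_triang d B x y : normb d B (badd x y) <= normb d B x + normb d B y.
Proof.
  rewrite !normb_normv. eapply Rle_trans; [|apply normv_triang].
  apply normv_mono; intros l _; split; [apply normv_nonneg | apply normv_triang].
Qed.

Lemma normb_sub_triang d B x y z :
  normb d B (bsub x z) <= normb d B (bsub x y) + normb d B (bsub y z).
Proof.
  eapply Rle_trans; [|apply normb_triang]. right.
  apply normb_ext; intros l _ k _; unfold badd, bsub; ring.
Qed.

Lemma normb_sub_sym d B x y : normb d B (bsub x y) = normb d B (bsub y x).
Proof.
  rewrite !normb_normv. apply normv_ext; intros l _. apply (normv_sub_sym d (x l) (y l)).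
Qed.

Lemma normb_le_sum d B x : normb d B x <= rsum B (fun l => rsum d (fun k => Rabs (x l k))).
Proof.
  rewrite normb_normv. eapply Rle_trans; [apply normv_le_sum|].
  apply rsum_le; intros l _. rewrite Rabs_pos_eq by apply normv_nonneg. apply normv_le_sum.
Qed.

Lemma normv_rsum d n (f : nat -> vec) :
  normv d (fun k => rsum n (fun i => f i k)) <= rsum n (fun i => normv d (f i)).
Proof.
  induction n as [|n IH]; simpl.
  - right. apply (normv_vzero d).
  - eapply Rle_trans; [apply (normv_triang d (fun k => rsum n (fun i => f i k)) (f n))|]. lra.
Qed.

Lemma normb_sub_le d B x y : normb d B (bsub x y) <= normb d B x + normb d B y.
Proof.
  replace (normb d B y) with (normb d B (fun l k => -1 * y l k))
    by (rewrite normb_scal, Rabs_left by lra; ring).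
  eapply Rle_trans; [|apply normb_triang]. right.
  apply normb_ext; intros l _ k _; unfold badd, bsub; ring.
Qed.

(** * Bounds uniform over finitely many indices *)

(** Monotonicity in the constant lets the maximum of finitely many constants serve all indices. This
    is how constants given per agent, block or coordinate become common ones. *)
Lemma uniform_bound n (P : nat -> R -> Prop) :
  (forall i C C', C <= C' -> P i C -> P i C') ->
  (forall i, (i < n)%nat -> exists C, P i C) ->
  exists C, 0 <= C /\ forall i, (i < n)%nat -> P i C.
Proof.
  intros Hmono. induction n as [|n IH]; intros H.
  - exists 0. split; [lra | intros; lia].
  - destruct IH as [C [HC0 HC]]; [intros; apply H; lia|].
    destruct (H n ltac:(lia)) as [C' HC'].
    exists (Rmax C C'). split; [eapply Rle_trans; [exact HC0 | apply Rmax_l]|].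
    intros i Hi. destruct (Nat.eq_dec i n) as [->|].
    + eapply Hmono; [apply Rmax_r | exact HC'].
    + eapply Hmono; [apply Rmax_l | apply HC; lia].
Qed.

Lemma uniform_nat_bound n (P : nat -> nat -> Prop) :
  (forall i m m', (m <= m')%nat -> P i m -> P i m') ->
  (forall i, (i < n)%nat -> exists m, P i m) ->
  exists m, forall i, (i < n)%nat -> P i m.
Proof.
  intros Hmono. induction n as [|n IH]; intros H.
  - exists 0%nat. intros; lia.
  - destruct IH as [m Hm]; [intros; apply H; lia|].
    destruct (H n ltac:(lia)) as [m' Hm'].
    exists (Nat.max m m'). intros i Hi. destruct (Nat.eq_dec i n) as [->|].
    + eapply Hmono; [apply Nat.le_max_r | exact Hm'].
    + eapply Hmono; [apply Nat.le_max_l | apply Hm; lia].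
Qed.

(** * Summable sequences *)

Definition summable (a : nat -> R) : Prop := exists C, forall n, rsum n a <= C.

Lemma summable_le a b : (forall t, a t <= b t) -> summable b -> summable a.
Proof.
  intros H [C HC]. exists C. intros n.
  eapply Rle_trans; [apply rsum_le; intros; apply H | apply HC].
Qed.

Lemma summable_plus a b : summable a -> summable b -> summable (fun t => a t + b t).
Proof.
  intros [C HC] [C' HC']. exists (C + C'). intros n. rewrite rsum_plus.
  specialize (HC n); specialize (HC' n); lra.
Qed.

Lemma summable_scal c a : 0 <= c -> summable a -> summable (fun t => c * a t).
Proof. intros Hc [C HC]. exists (c * C). intros n. rewrite rsum_scal. specialize (HC n). nra. Qed.

Lemma summable_shift a m : (forall t, 0 <= a t) -> summable a -> summable (fun t => a (m + t)%nat).
Proof.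
  intros Ha [C HC]. exists C. intros n.
  pose proof (rsum_add_nat m n a). pose proof (rsum_nonneg m a ltac:(auto)).
  specialize (HC (m + n)%nat). lra.
Qed.

Lemma summable_rsum m (a : nat -> nat -> R) :
  (forall i, (i < m)%nat -> summable (a i)) -> summable (fun t => rsum m (fun i => a i t)).
Proof.
  induction m as [|m IH]; intros H; simpl.
  - exists 0. intros n. rewrite rsum_const. lra.
  - apply summable_plus; [apply IH; intros; apply H; lia | apply H; lia].
Qed.

(** Once a partial sum is within [eps] of the supremum of all of them, what is added later stays
    below [eps]. *)
Lemma summable_tail a :
  (forall t, 0 <= a t) -> summable a ->
  forall eps, 0 < eps -> exists T, forall n, rsum n (fun t => a (T + t)%nat) < eps.
Proof.
  intros Ha [C HC] eps Heps.
  destruct (completeness (fun v => exists n, v = rsum n a)) as [S [Hub Hlub]].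
  - exists C. intros v [n ->]. apply HC.
  - exists 0, 0%nat. reflexivity.
  - assert (HT : exists T, S - eps < rsum T a).
    { destruct (Classical_Prop.classic (exists T, S - eps < rsum T a)) as [|Hno]; [assumption|].
      exfalso. assert (S <= S - eps); [|lra].
      apply Hlub. intros v [n ->]. apply Rnot_lt_le. intros Hlt. apply Hno. now exists n. }
    destruct HT as [T HT]. exists T. intros n.
    assert (rsum (T + n) a <= S) by (apply Hub; now exists (T + n)%nat).
    rewrite rsum_add_nat in H. lra.
Qed.

Lemma summable_lim0 a :
  (forall t, 0 <= a t) -> summable a ->
  forall eps, 0 < eps -> exists T, forall t, (T <= t)%nat -> a t < eps.
Proof.
  intros Ha Hs eps Heps. destruct (summable_tail a Ha Hs eps Heps) as [T HT].
  exists T. intros t Ht. apply Rle_lt_trans with (2 := HT (S (t - T))).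
  replace t with (T + (t - T))%nat at 1 by lia.
  apply (rsum_term_le (S (t - T)) (fun t => a (T + t)%nat)); [intros; apply Ha | lia].
Qed.

Lemma summable_sqr_lim0 a :
  (forall t, 0 <= a t) -> summable (fun t => a t ^ 2) ->
  forall eps, 0 < eps -> exists T, forall t, (T <= t)%nat -> a t < eps.
Proof.
  intros Ha Hs eps Heps.
  destruct (summable_lim0 (fun t => a t ^ 2) ltac:(intros; apply pow2_ge_0) Hs (eps ^ 2)) as [T HT].
  { apply pow_lt; lra. }
  exists T. intros t Ht. specialize (HT t Ht). specialize (Ha t). nra.
Qed.

Lemma summable_mul a b :
  summable (fun t => a t ^ 2) -> summable (fun t => b t ^ 2) -> summable (fun t => a t * b t).
Proof.
  intros Ha Hb. apply summable_le with (fun t => a t ^ 2 + b t ^ 2).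
  - intros t. pose proof (pow2_ge_0 (a t - b t)). pose proof (pow2_ge_0 (a t + b t)). nra.
  - now apply summable_plus.
Qed.

Lemma summable_sqr_plus a b :
  summable (fun t => a t ^ 2) -> summable (fun t => b t ^ 2) ->
  summable (fun t => (a t + b t) ^ 2).
Proof.
  intros Ha Hb. apply summable_le with (fun t => 2 * (a t ^ 2 + b t ^ 2)).
  - intros t. pose proof (pow2_ge_0 (a t - b t)). nra.
  - apply summable_scal; [lra|]. now apply summable_plus.
Qed.

Lemma summable_sqr_rsum m (a : nat -> nat -> R) :
  (forall i, (i < m)%nat -> summable (fun t => a i t ^ 2)) ->
  summable (fun t => rsum m (fun i => a i t) ^ 2).
Proof.
  induction m as [|m IH]; intros H; simpl rsum.
  - exists 0. intros n. rewrite rsum_const. lra.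
  - apply summable_sqr_plus; [apply IH; intros; apply H; lia | apply H; lia].
Qed.

Lemma summable_sqr_scal c a : summable (fun t => a t ^ 2) -> summable (fun t => (c * a t) ^ 2).
Proof.
  intros H. apply summable_le with (fun t => c ^ 2 * a t ^ 2).
  - intros t. nra.
  - apply summable_scal; [nra | exact H].
Qed.

(** * Convex sets and convex functions *)

(** The norm does not see coordinates beyond [d], so a closed set cannot see them either; membership
    in [K l] thus respects [eqv] without a separate hypothesis. *)
Lemma closed_vset_ext d S u v : closed_vset d S -> S u -> eqv d u v -> S v.
Proof.
  intros HS Hu Huv. apply HS. intros eps Heps. exists u. split; [exact Hu|].
  rewrite (normv_ext d (vsub u v) vzero), normv_vzero; [exact Heps|].
  intros k Hk. unfold vsub, vzero. rewrite (Huv k Hk). ring.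
Qed.

(** Dividing by the total weight keeps the induction going, since partial sums of the weights need
    not be 1. If the first [n] weights have total 0, they all vanish and the combination is
    [v n]. *)
Lemma convex_comb_normalized d S n (w : nat -> R) (v : nat -> vec) :
  closed_vset d S -> convex_vset S ->
  (forall j, (j < n)%nat -> 0 <= w j) -> 0 < rsum n w ->
  (forall j, (j < n)%nat -> S (v j)) ->
  S (fun k => rsum n (fun j => w j * v j k) / rsum n w).
Proof.
  intros Hcl Hcv. induction n as [|n IH]; intros Hw HW Hv; [simpl in HW; lra|].
  simpl rsum in *.
  assert (Hw' : forall j, (j < n)%nat -> 0 <= w j) by (intros; apply Hw; lia).
  assert (Hwn : 0 <= w n) by (apply Hw; lia).
  destruct (Rle_lt_or_eq_dec 0 (rsum n w)) as [Hpos|H0]; [now apply rsum_nonneg| |].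
  - set (W := rsum n w) in *.
    eapply closed_vset_ext; [exact Hcl | apply (Hcv _ (v n) (W / (W + w n))
      (IH Hw' Hpos (fun j Hj => Hv j ltac:(lia))) (Hv n ltac:(lia)))|].
    + split; [apply Rle_mult_inv_pos; lra|].
      apply Rmult_le_reg_r with (W + w n); [lra|].
      unfold Rdiv; rewrite Rmult_assoc, Rinv_l; lra.
    + intros k _. unfold vadd, vscal. field. lra.
  - eapply closed_vset_ext; [exact Hcl | apply (Hv n); lia|].
    intros k _. rewrite (rsum_zero n (fun j => w j * v j k)).
    + rewrite <- H0 in *. field. lra.
    + intros j Hj. pose proof (rsum_term_le n w j Hw' Hj). pose proof (Hw' j Hj).
      replace (w j) with 0 by lra. ring.
Qed.

Lemma convex_comb_mem d S n (w : nat -> R) (v : nat -> vec) :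
  closed_vset d S -> convex_vset S ->
  (forall j, (j < n)%nat -> 0 <= w j) -> rsum n w = 1 ->
  (forall j, (j < n)%nat -> S (v j)) ->
  S (fun k => rsum n (fun j => w j * v j k)).
Proof.
  intros Hcl Hcv Hw HW Hv. eapply closed_vset_ext; [exact Hcl| |].
  - apply (convex_comb_normalized d S n w v); auto. lra.
  - intros k _. cbv beta. rewrite HW. field.
Qed.

(* One-dimensional Hahn-Banach extension: the slope along the new coordinate is the supremum of
   the backward difference quotients, which convexity bounds by every forward one. *)
Lemma subgrad_extend (r : vec -> R) (z g : vec) (m : nat) :
  convex_fun r -> (forall u v, (forall k, u k = v k) -> r u = r v) ->
  (forall h, (forall k, (m <= k)%nat -> h k = 0) -> r z + ipv m g h <= r (vadd z h)) ->
  exists c, forall h, (forall k, (S m <= k)%nat -> h k = 0) ->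
    r z + (ipv m g h + c * h m) <= r (vadd z h).
Proof.
  intros Hcv Hrel Hg.
  set (pt := fun (h : vec) (s : R) => (fun k => z k + h k + (if Nat.eqb k m then s else 0)) : vec).
  set (supp := fun h : vec => forall k, (m <= k)%nat -> h k = 0).
  assert (Hcross : forall h h' s s', supp h -> supp h' -> 0 < s -> 0 < s' ->
            (r z + ipv m g h - r (pt h (- s))) / s <= (r (pt h' s') - r z - ipv m g h') / s').
  { intros h h' s s' Hh Hh' Hs Hs'.
    (* With this weight the displacements [- s] and [s'] along coordinate [m] cancel, so the
       combined point lies where [Hg] applies. *)
    set (th := s' / (s + s')).
    assert (Hth1 : 1 - th = s / (s + s')) by (unfold th; field; lra).
    assert (Hth : 0 <= th <= 1).
    { assert (0 <= th) by (apply Rle_mult_inv_pos; lra).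
      assert (0 <= 1 - th) by (rewrite Hth1; apply Rle_mult_inv_pos; lra). lra. }
    set (h0 := vadd (vscal th h) (vscal (1 - th) h')).
    assert (H1 : r z + ipv m g h0 <= r (vadd z h0)).
    { apply Hg. intros k Hk. unfold h0, vadd, vscal. rewrite (Hh k Hk), (Hh' k Hk). ring. }
    pose proof (Hcv (pt h (- s)) (pt h' s') th Hth) as H2.
    rewrite (Hrel _ (vadd z h0)) in H2.
    2:{ intros k. unfold pt, h0, vadd, vscal. destruct (Nat.eqb k m).
        - unfold th. field. lra.
        - ring. }
    assert (Hip0 : ipv m g h0 = th * ipv m g h + (1 - th) * ipv m g h')
      by (unfold h0; now rewrite ipv_add_r, !ipv_scal_r).
    rewrite Hip0, Hth1 in H1. rewrite Hth1 in H2.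
    assert (H3 : r z + (th * ipv m g h + s / (s + s') * ipv m g h')
                 <= th * r (pt h (- s)) + s / (s + s') * r (pt h' s')) by lra.
    unfold th in H3.
    apply Rmult_le_compat_r with (r := s + s') in H3; [|lra].
    replace ((r z + (s' / (s + s') * ipv m g h + s / (s + s') * ipv m g h')) * (s + s'))
      with (s' * (r z + ipv m g h) + s * (r z + ipv m g h')) in H3 by (field; lra).
    replace ((s' / (s + s') * r (pt h (- s)) + s / (s + s') * r (pt h' s')) * (s + s'))
      with (s' * r (pt h (- s)) + s * r (pt h' s')) in H3 by (field; lra).
    apply Rmult_le_reg_r with (s * s'); [nra|].
    replace ((r z + ipv m g h - r (pt h (- s))) / s * (s * s'))
      with (s' * (r z + ipv m g h - r (pt h (- s)))) by (field; lra).
    replace ((r (pt h' s') - r z - ipv m g h') / s' * (s * s'))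
      with (s * (r (pt h' s') - r z - ipv m g h')) by (field; lra).
    lra. }
  assert (Hsupp0 : supp vzero) by (intros k _; reflexivity).
  destruct (completeness (fun v => exists h s, supp h /\ 0 < s /\
              v = (r z + ipv m g h - r (pt h (- s))) / s)) as [c [Hub Hlub]].
  - exists ((r (pt vzero 1) - r z - ipv m g vzero) / 1).
    intros v (h & s & Hh & Hs & ->). apply Hcross; auto; lra.
  - eexists. exists vzero, 1. split; [exact Hsupp0|]. split; [lra | reflexivity].
  - exists c. intros h Hh.
    set (h0 := (fun k => if Nat.eqb k m then 0 else h k) : vec).
    assert (Hh0 : supp h0).
    { intros k Hk. unfold h0. destruct (Nat.eqb_spec k m); [reflexivity | apply Hh; lia]. }
    assert (Hip : ipv m g h = ipv m g h0).
    { apply ipv_ext; intros k Hk; [reflexivity|]. unfold h0.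
      destruct (Nat.eqb_spec k m); [lia | reflexivity]. }
    assert (Hpt : r (vadd z h) = r (pt h0 (h m))).
    { apply Hrel. intros k. unfold pt, h0, vadd. destruct (Nat.eqb_spec k m) as [->|]; ring. }
    rewrite Hip, Hpt. destruct (Rtotal_order (h m) 0) as [Hneg|[Hz|Hpos]].
    + assert (Hc : (r z + ipv m g h0 - r (pt h0 (h m))) / (- h m) <= c).
      { apply Hub. exists h0, (- h m). split; [exact Hh0|]. split; [lra|].
        now rewrite Ropp_involutive. }
      apply Rmult_le_compat_r with (r := - h m) in Hc; [|lra].
      replace ((r z + ipv m g h0 - r (pt h0 (h m))) / - h m * - h m)
        with (r z + ipv m g h0 - r (pt h0 (h m))) in Hc by (field; lra).
      lra.
    + rewrite Hz, Rmult_0_r, Rplus_0_r.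
      eapply Rle_trans; [apply Hg, Hh0|]. right. apply Hrel.
      intros k. unfold pt, vadd. destruct (Nat.eqb k m); ring.
    + assert (Hc : c <= (r (pt h0 (h m)) - r z - ipv m g h0) / h m).
      { apply Hlub. intros v (h' & s & Hh' & Hs & ->). now apply Hcross. }
      apply Rmult_le_compat_r with (r := h m) in Hc; [|lra].
      replace ((r (pt h0 (h m)) - r z - ipv m g h0) / h m * h m)
        with (r (pt h0 (h m)) - r z - ipv m g h0) in Hc by (field; lra).
      lra.
Qed.

(** Coordinates are added one at a time, from none up to [d]. The direction [w - z] may be truncated
    to its first [d] coordinates because [r] ignores the others. *)
Lemma subgrad_exists d (r : vec -> R) (z : vec) :
  convex_fun r -> (forall u v, eqv d u v -> r u = r v) -> exists g, is_subgrad d r z g.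
Proof.
  intros Hcv Hrel.
  assert (Hrel' : forall u v, (forall k, u k = v k) -> r u = r v)
    by (intros u v H; apply Hrel; intros k _; apply H).
  assert (Hm : forall m, exists g, forall h, (forall k, (m <= k)%nat -> h k = 0) ->
                 r z + ipv m g h <= r (vadd z h)).
  { induction m as [|m [g Hg]].
    - exists vzero. intros h Hh. right. unfold ipv; simpl. rewrite Rplus_0_r.
      apply Hrel'. intros k. unfold vadd. rewrite (Hh k) by lia. ring.
    - destruct (subgrad_extend r z g m Hcv Hrel' Hg) as [c Hc].
      exists (fun k => if Nat.eqb k m then c else g k). intros h Hh.
      replace (ipv (S m) (fun k => if Nat.eqb k m then c else g k) h)
        with (ipv m g h + c * h m); [now apply Hc|].
      unfold ipv; simpl. rewrite Nat.eqb_refl. f_equal.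
      apply rsum_ext; intros k Hk. destruct (Nat.eqb_spec k m); [lia | reflexivity]. }
  destruct (Hm d) as [g Hg]. exists g. intros w.
  set (h := (fun k => if Nat.ltb k d then w k - z k else 0) : vec).
  rewrite (ipv_ext d g g (vsub w z) h).
  - rewrite (Hrel w (vadd z h)).
    + apply Hg. intros k Hk. unfold h. destruct (Nat.ltb_spec k d); [lia | reflexivity].
    + intros k Hk. unfold vadd, h. destruct (Nat.ltb_spec k d); [ring | lia].
  - intros k _; reflexivity.
  - intros k Hk. unfold vsub, h. destruct (Nat.ltb_spec k d); [ring | lia].
Qed.

(** A subgradient at [u], of norm at most [M], limits how far [r] can fall between [u] and [v]. *)
Lemma convex_lipschitz_on d S (r : vec -> R) :
  convex_fun r -> (forall u v, eqv d u v -> r u = r v) -> bounded_subgrad_on d S r ->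
  exists L, forall u v, S u -> S v -> r u - r v <= L * normv d (vsub u v).
Proof.
  intros Hcv Hrel [M HM]. exists M. intros u v Hu Hv.
  destruct (subgrad_exists d r u Hcv Hrel) as [g Hg].
  pose proof (HM u g Hu Hg). pose proof (Hg v) as H1.
  assert (ipv d g (vsub v u) = - ipv d g (vsub u v)) by (rewrite !ipv_sub_r; ring).
  pose proof (ipv_CS d g (vsub u v)). pose proof (normv_nonneg d (vsub u v)). nra.
Qed.

(** Average the supporting affine function at the barycentre [p]: its linear part averages to 0. *)
Lemma jensen d (r : vec -> R) n (w : nat -> R) (v : nat -> vec) :
  convex_fun r -> (forall u v, eqv d u v -> r u = r v) ->
  (forall j, (j < n)%nat -> 0 <= w j) -> rsum n w = 1 ->
  r (fun k => rsum n (fun j => w j * v j k)) <= rsum n (fun j => w j * r (v j)).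
Proof.
  intros Hcv Hrel Hw HW.
  set (p := (fun k => rsum n (fun j => w j * v j k)) : vec).
  destruct (subgrad_exists d r p Hcv Hrel) as [g Hg].
  assert (H : rsum n (fun j => w j * (r p + ipv d g (vsub (v j) p)))
              <= rsum n (fun j => w j * r (v j))).
  { apply rsum_le; intros j Hj. apply Rmult_le_compat_l; [now apply Hw | apply Hg]. }
  replace (r p) with (rsum n (fun j => w j * (r p + ipv d g (vsub (v j) p)))); [exact H|].
  assert (Hp : ipv d g p = rsum n (fun j => w j * ipv d g (v j))).
  { transitivity (rsum n (fun j => ipv d g (vscal (w j) (v j)))).
    - apply (ipv_rsum_r d n (fun j => vscal (w j) (v j)) g).
    - apply rsum_ext; intros; apply ipv_scal_r. }
  transitivity (rsum n w * (r p - ipv d g p) + ipv d g p); [|rewrite HW; ring].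
  rewrite Hp at 2. rewrite <- rsum_scal_r, <- rsum_plus. apply rsum_ext; intros j _.
  rewrite ipv_sub_r. ring.
Qed.

(** * First-order conditions for convex minimization *)

(** Packages the limits [th -> 0] and then [eps -> 0]: [c * th] is what remains of a second-order
    term after division by [th], and [eps * k] is the differentiability remainder. *)
Lemma le_of_small_perturbation a b c k :
  (forall eps, 0 < eps -> exists th0, 0 < th0 /\
     forall th, 0 < th < th0 -> a <= b + c * th + eps * k) -> a <= b.
Proof.
  intros H. apply le_epsilon. intros eps Heps.
  pose proof (Rabs_pos c). pose proof (Rabs_pos k).
  destruct (H (eps / (2 * (Rabs k + 1)))) as (th0 & Hth0 & Hle).
  { apply Rdiv_lt_0_compat; lra. }
  set (th1 := eps / (2 * (Rabs c + 1))).
  assert (Hth1 : 0 < th1) by (apply Rdiv_lt_0_compat; lra).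
  assert (Hth : 0 < Rmin (th0 / 2) th1) by (apply Rmin_glb_lt; lra).
  pose proof (Rmin_l (th0 / 2) th1). pose proof (Rmin_r (th0 / 2) th1).
  specialize (Hle (Rmin (th0 / 2) th1) ltac:(lra)).
  set (th := Rmin (th0 / 2) th1) in *.
  assert (c * th <= eps / 2).
  { apply Rle_trans with (Rabs c * th); [pose proof (Rle_abs c); nra|].
    apply Rle_trans with ((Rabs c + 1) * th1); [nra|]. right. unfold th1. field. lra. }
  assert (eps / (2 * (Rabs k + 1)) * k <= eps / 2).
  { apply Rle_trans with (eps / (2 * (Rabs k + 1)) * (Rabs k + 1)).
    - apply Rmult_le_compat_l; [left; apply Rdiv_lt_0_compat; lra|].
      pose proof (Rle_abs k). lra.
    - right. field. lra. }
  lra.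
Qed.

Lemma has_grad_v_direction d f g z h :
  has_grad_v d f g z -> forall eps, 0 < eps -> exists th0, 0 < th0 /\
    forall th, 0 < th < th0 ->
      Rabs (f (vadd z (vscal th h)) - f z - th * ipv d g h) <= eps * (th * normv d h).
Proof.
  intros Hg eps Heps. destruct (Hg eps Heps) as (del & Hdel & H).
  pose proof (normv_nonneg d h).
  exists (del / (normv d h + 1)). split; [apply Rdiv_lt_0_compat; lra|].
  intros th [Hth0 Hth].
  assert (Hn : normv d (vscal th h) = th * normv d h) by (rewrite normv_scal, Rabs_pos_eq; lra).
  rewrite <- Hn, <- ipv_scal_r. apply H. rewrite Hn.
  apply Rmult_lt_compat_r with (r := normv d h + 1) in Hth; [|lra].
  unfold Rdiv in Hth. rewrite Rmult_assoc, Rinv_l in Hth by lra. nra.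
Qed.

(** Strong convexity on the segment from [z] to [u], divided by the weight [th] of [u], with [th]
    tending to 0. The factor [1 - th] of the quadratic term accounts for the choice of [c]. *)
Lemma strongly_convex_lower_bound d S f tau g z u :
  (forall u v, eqv d u v -> f u = f v) ->
  strongly_convex_on d S f tau -> has_grad_v d f g z -> S z -> S u ->
  f z + ipv d g (vsub u z) + tau / 2 * normv d (vsub u z) ^ 2 <= f u.
Proof.
  intros Hrel Hsc Hg Hz Hu. set (h := vsub u z). set (n := normv d h).
  apply le_of_small_perturbation with (c := tau / 2 * n ^ 2) (k := n).
  intros eps Heps. destruct (has_grad_v_direction d f g z h Hg eps Heps) as (th0 & Hth0 & H).
  exists (Rmin th0 1). split; [apply Rmin_glb_lt; lra|]. intros th [Hth Hth'].
  pose proof (Rmin_l th0 1). pose proof (Rmin_r th0 1).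
  specialize (H th ltac:(lra)). fold n in H.
  pose proof (Hsc u z th Hu Hz ltac:(lra)) as H2. fold h n in H2.
  rewrite (Hrel (vadd (vscal th u) (vscal (1 - th) z)) (vadd z (vscal th h))) in H2.
  2:{ intros k _. unfold h, vadd, vscal, vsub. ring. }
  pose proof (Rle_abs (- (f (vadd z (vscal th h)) - f z - th * ipv d g h))) as H3.
  rewrite Rabs_Ropp in H3.
  assert (H4 : th * (f z + ipv d g h + tau / 2 * n ^ 2)
               <= th * (f u + tau / 2 * n ^ 2 * th + eps * n)) by nra.
  apply Rmult_le_reg_l with th; lra.
Qed.

(** Compare [xt] with points slightly moved towards [z]: [f] is expanded to first order, while [r],
    not assumed differentiable, is bounded by convexity. The base point [p] only shifts a constant
    and cancels. *)
Lemma minimizer_variational_inequality d S f c p r g xt z :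
  (forall u v, eqv d u v -> f u = f v) -> convex_vset S -> convex_fun r ->
  has_grad_v d f g xt -> S xt -> S z ->
  (forall u, S u -> f xt + ipv d c (vsub xt p) + r xt <= f u + ipv d c (vsub u p) + r u) ->
  0 <= ipv d (vadd g c) (vsub z xt) + (r z - r xt).
Proof.
  intros Hrel Hcv Hr Hg Hxt Hz Hmin. set (h := vsub z xt).
  apply le_of_small_perturbation with (c := 0) (k := normv d h).
  intros eps Heps. destruct (has_grad_v_direction d f g xt h Hg eps Heps) as (th0 & Hth0 & H).
  exists (Rmin th0 1). split; [apply Rmin_glb_lt; lra|]. intros th [Hth Hth'].
  pose proof (Rmin_l th0 1). pose proof (Rmin_r th0 1).
  specialize (H th ltac:(lra)).
  pose proof (Hmin _ (Hcv z xt th Hz Hxt ltac:(lra))) as H2.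
  pose proof (Hr z xt th ltac:(lra)) as H3.
  rewrite (Hrel (vadd (vscal th z) (vscal (1 - th) xt)) (vadd xt (vscal th h))) in H2.
  2:{ intros k _. unfold h, vadd, vscal, vsub. ring. }
  pose proof (Rle_abs (f (vadd xt (vscal th h)) - f xt - th * ipv d g h)) as H4.
  assert (H5 : ipv d c (vsub (vadd (vscal th z) (vscal (1 - th) xt)) p)
               = ipv d c (vsub xt p) + th * ipv d c h).
  { unfold h. rewrite !ipv_sub_r, ipv_add_r, !ipv_scal_r. ring. }
  rewrite ipv_add_l.
  apply Rmult_le_reg_l with th; [lra|]. rewrite H5 in H2. nra.
Qed.

(** * Mean value inequalities along segments *)

Definition bseg (x y : bvec) (c : R) : bvec := fun l k => x l k + c * (y l k - x l k).

Lemma bseg_mem d B K x y c :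
  (forall l, (l < B)%nat -> closed_vset d (K l) /\ convex_vset (K l)) ->
  inK B K x -> inK B K y -> 0 <= c <= 1 -> inK B K (bseg x y c).
Proof.
  intros HK Hx Hy Hc l Hl. destruct (HK l Hl) as [Hcl Hcv].
  eapply closed_vset_ext; [exact Hcl | apply (Hcv (y l) (x l) c (Hy l Hl) (Hx l Hl) Hc)|].
  intros k _. unfold bseg, vadd, vscal. ring.
Qed.

(** The segment stays in [K] by convexity, and at each of its points the gradient controls all
    directions, so the restriction of [f] to it has a two-sided derivative even at the endpoints;
    the one-dimensional mean value theorem then applies. *)
Lemma mean_value_bseg d B (K : nat -> vec -> Prop) f G x y :
  (forall l, (l < B)%nat -> closed_vset d (K l) /\ convex_vset (K l)) ->
  (forall u v, eqbv d B u v -> f u = f v) ->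
  (forall u, inK B K u -> has_grad_b d B f (G u) u) ->
  inK B K x -> inK B K y ->
  exists c, 0 <= c <= 1 /\ f y - f x = ipb d B (G (bseg x y c)) (bsub y x).
Proof.
  intros HK Hrel Hg Hx Hy. set (h := bsub y x).
  destruct (MVT_cor2 (fun c => f (bseg x y c)) (fun c => ipb d B (G (bseg x y c)) h) 0 1)
    as (c & Hc & Hc01); [lra| |].
  - intros c Hc. intros eps Heps. pose proof (normb_nonneg d B h) as Hn.
    (* The [+ 1] in the tolerance covers the case [h = 0]; the factor 2 makes the final inequality
       strict. *)
    destruct (Hg _ (bseg_mem d B K x y c HK Hx Hy Hc) (eps / (2 * (normb d B h + 1))))
      as (del & Hdel & H).
    { apply Rdiv_lt_0_compat; lra. }
    assert (Hdel' : 0 < del / (normb d B h + 1)) by (apply Rdiv_lt_0_compat; lra).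
    exists (mkposreal _ Hdel'). intros s Hs0 Hs. simpl in Hs.
    pose proof (Rabs_pos_lt s Hs0) as Hsp.
    specialize (H (fun l k => s * h l k)). rewrite normb_scal in H.
    assert (Hlt : Rabs s * normb d B h < del).
    { apply Rmult_lt_compat_r with (r := normb d B h + 1) in Hs; [|lra].
      unfold Rdiv in Hs. rewrite Rmult_assoc, Rinv_l in Hs by lra. nra. }
    specialize (H Hlt).
    rewrite (Hrel (badd _ _) (bseg x y (c + s))) in H.
    2:{ intros l _ k _. unfold badd, bseg, h, bsub. ring. }
    replace (ipb d B (G (bseg x y c)) (fun l k => s * h l k))
      with (s * ipb d B (G (bseg x y c)) h) in H.
    2:{ unfold ipb. rewrite <- rsum_scal. apply rsum_ext; intros l _.
        symmetry. apply (ipv_scal_r d s). }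
    replace ((f (bseg x y (c + s)) - f (bseg x y c)) / s - ipb d B (G (bseg x y c)) h)
      with ((f (bseg x y (c + s)) - f (bseg x y c) - s * ipb d B (G (bseg x y c)) h) * / s)
      by (field; exact Hs0).
    rewrite Rabs_mult, Rabs_inv.
    apply Rle_lt_trans with (eps / (2 * (normb d B h + 1)) * (Rabs s * normb d B h) * / Rabs s).
    { apply Rmult_le_compat_r; [left; now apply Rinv_0_lt_compat | exact H]. }
    replace (eps / (2 * (normb d B h + 1)) * (Rabs s * normb d B h) * / Rabs s)
      with (eps * (normb d B h / (2 * (normb d B h + 1)))) by (field; lra).
    assert (normb d B h / (2 * (normb d B h + 1)) < 1); [|nra].
    apply Rmult_lt_reg_r with (2 * (normb d B h + 1)); [lra|].
    unfold Rdiv. rewrite Rmult_assoc, Rinv_l; lra.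
  - exists c. split; [lra|]. rewrite Rminus_0_r, Rmult_1_r in Hc. rewrite <- Hc.
    rewrite (Hrel (bseg x y 1) y), (Hrel (bseg x y 0) x); [reflexivity| |];
      intros l _ k _; unfold bseg; ring.
Qed.

(** The mean value theorem compares the gradients at [xi] and [x], at distance at most that of [y]
    and [x]. This gives [L] where integration would give [L / 2], a difference without effect on
    summability. *)
Lemma descent_lemma d B (K : nat -> vec -> Prop) f G L x y :
  (forall l, (l < B)%nat -> closed_vset d (K l) /\ convex_vset (K l)) ->
  (forall u v, eqbv d B u v -> f u = f v) ->
  (forall u, inK B K u -> has_grad_b d B f (G u) u) ->
  lipschitz_on_b d B (inK B K) G L -> 0 <= L ->
  inK B K x -> inK B K y ->
  f y <= f x + ipb d B (G x) (bsub y x) + L * normb d B (bsub y x) ^ 2.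
Proof.
  intros HK Hrel Hg HL HL0 Hx Hy.
  destruct (mean_value_bseg d B K f G x y HK Hrel Hg Hx Hy) as (c & Hc & Heq).
  set (xi := bseg x y c) in *. set (h := bsub y x) in *.
  pose proof (HL xi x (bseg_mem d B K x y c HK Hx Hy Hc) Hx) as H1.
  assert (Hxi : normb d B (bsub xi x) <= normb d B h).
  { rewrite (normb_ext d B (bsub xi x) (fun l k => c * h l k)).
    - rewrite normb_scal, Rabs_pos_eq by lra. pose proof (normb_nonneg d B h). nra.
    - intros l _ k _. unfold xi, h, bsub, bseg. ring. }
  assert (Hd : ipb d B (G xi) h = ipb d B (G x) h + ipb d B (bsub (G xi) (G x)) h).
  { unfold ipb. rewrite <- rsum_plus. apply rsum_ext; intros l _.
    rewrite <- ipv_add_l. apply ipv_ext; intros k _; [|reflexivity].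
    unfold vadd, bsub. ring. }
  pose proof (ipb_CS_abs d B (bsub (G xi) (G x)) h) as H2.
  pose proof (Rle_abs (ipb d B (bsub (G xi) (G x)) h)).
  pose proof (normb_nonneg d B h). pose proof (normb_nonneg d B (bsub xi x)).
  assert (normb d B (bsub (G xi) (G x)) <= L * normb d B h) by nra.
  nra.
Qed.

Lemma bounded_grad_lipschitz d B (K : nat -> vec -> Prop) f G M x y :
  (forall l, (l < B)%nat -> closed_vset d (K l) /\ convex_vset (K l)) ->
  (forall u v, eqbv d B u v -> f u = f v) ->
  (forall u, inK B K u -> has_grad_b d B f (G u) u) ->
  (forall u, inK B K u -> normb d B (G u) <= M) ->
  inK B K x -> inK B K y ->
  f y - f x <= M * normb d B (bsub y x).
Proof.
  intros HK Hrel Hg HM Hx Hy.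
  destruct (mean_value_bseg d B K f G x y HK Hrel Hg Hx Hy) as (c & Hc & ->).
  eapply Rle_trans; [apply Rle_abs|]. eapply Rle_trans; [apply ipb_CS_abs|].
  apply Rmult_le_compat_r; [apply normb_nonneg|]. apply HM. now apply (bseg_mem d).
Qed.

(** * Consensus over a time-varying digraph *)

(** A walk of [s] arcs whose [u]-th arc, counted from 0, is available at time [t + u]. *)
Inductive reach (edge : nat -> nat -> nat -> Prop) (t : nat) : nat -> nat -> nat -> Prop :=
| reach_refl j : reach edge t 0 j j
| reach_step s j i i' : reach edge t s j i -> edge (t + s)%nat i i' -> reach edge t (S s) j i'.

Lemma reach_trans edge t s1 s2 a b c :
  reach edge t s1 a b -> reach edge (t + s1) s2 b c -> reach edge t (s1 + s2) a c.
Proof.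
  intros H1 H2. induction H2 as [|s j i i' _ IH Hi].
  - now rewrite Nat.add_0_r.
  - rewrite Nat.add_succ_r. eapply reach_step; [now apply IH|]. now rewrite Nat.add_assoc.
Qed.

Lemma reach_loop (edge : nat -> nat -> nat -> Prop) t s j :
  (forall u, edge u j j) -> reach edge t s j j.
Proof. intros H. induction s; econstructor; [eassumption | apply H]. Qed.

Definition block_edge (N : nat) E sel l (t j i : nat) : Prop :=
  (j < N)%nat /\ (i < N)%nat /\ in_Elt N E sel t i l j.

(** An arc of [E] carries block [l] as soon as its tail selects [l], which happens within a bounded
    delay from any starting time. Self-loops fill the waiting times, so a walk for one length yields
    walks for all larger ones, and a common length exists for all pairs. *)
Lemma block_edge_reach_uniform N E sel l :
  (forall i, (i < N)%nat -> E i i) -> strongly_connected N E ->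
  (forall i, (i < N)%nat -> exists T, (0 < T)%nat /\
     forall t, exists s, (s < T)%nat /\ sel (t + s)%nat i = l) ->
  exists T, (0 < T)%nat /\ forall t j i, (j < N)%nat -> (i < N)%nat ->
    reach (block_edge N E sel l) t T j i.
Proof.
  intros Hloop Hsc Hcov. set (edge := block_edge N E sel l).
  assert (Hself : forall i, (i < N)%nat -> forall t, edge t i i).
  { intros i Hi t. split; [exact Hi|]. split; [exact Hi|]. split; [now apply Hloop | now right]. }
  assert (Hpair : forall a b, clos_trans nat (fun a b => (a < N)%nat /\ (b < N)%nat /\ E a b) a b ->
            exists n, forall t s, (n <= s)%nat -> reach edge t s a b).
  { intros a b H. induction H as [a b (Ha & Hb & Hab)|a b c _ [n1 H1] _ [n2 H2]].
    - destruct (Hcov a Ha) as (T & _ & HT). exists T. intros t s Hs.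
      destruct (HT t) as (s0 & Hs0 & Hsel).
      (* Wait at [a] until it selects [l], cross to [b], then wait at [b]. *)
      replace s with (s0 + (1 + (s - s0 - 1)))%nat by lia.
      apply reach_trans with a; [apply reach_loop, Hself, Ha|].
      apply reach_trans with b; [|apply reach_loop, Hself, Hb].
      apply (reach_step edge (t + s0) 0 a a b); [constructor|]. rewrite Nat.add_0_r.
      split; [exact Ha|]. split; [exact Hb|]. split; [exact Hab | now left].
    - exists (n1 + n2)%nat. intros t s Hs. replace s with (n1 + (s - n1))%nat by lia.
      apply reach_trans with b; [apply H1 | apply H2]; lia. }
  destruct (uniform_nat_bound N (fun j n => forall i, (i < N)%nat ->
              forall t s, (n <= s)%nat -> reach edge t s j i)) as [n Hn].
  - intros j m m' Hm H i Hi t s Hs. apply H; [exact Hi | lia].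
  - intros j Hj.
    apply (uniform_nat_bound N (fun i n => forall t s, (n <= s)%nat -> reach edge t s j i)).
    + intros i m m' Hm H t s Hs. apply H. lia.
    + intros i Hi. now apply Hpair, Hsc.
  - exists (S n). split; [lia|]. intros t j i Hj Hi. apply Hn; auto; lia.
Qed.

(** * Push-sum weights *)

Section PushSum.

Context (N : nat) (edge : nat -> nat -> nat -> Prop) (A : nat -> nat -> nat -> R) (kappa : R)
  (phi : nat -> nat -> R) (Tw : nat)
  (HN : (1 <= N)%nat) (Hkappa : 0 < kappa)
  (Hloop : forall t i, (i < N)%nat -> edge t i i)
  (Hedge : forall t j i, edge t j i -> (j < N)%nat /\ (i < N)%nat /\ kappa < A t i j)
  (Hreach : forall t j i, (j < N)%nat -> (i < N)%nat -> reach edge t Tw j i)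
  (HA0 : forall t i j, (i < N)%nat -> (j < N)%nat -> 0 <= A t i j)
  (HAcol : forall t j, (j < N)%nat -> rsum N (fun i => A t i j) = 1)
  (Hphi0 : forall i, (i < N)%nat -> phi 0%nat i = 1)
  (HphiS : forall t i, (i < N)%nat -> phi (S t) i = rsum N (fun j => A t i j * phi t j)).

Lemma push_kappa_le_1 : kappa <= 1.
Proof.
  destruct (Hedge 0 0 0 (Hloop 0 0 ltac:(lia)))%nat as (_ & _ & H).
  pose proof (rsum_term_le N (fun i => A 0 i 0)%nat 0%nat ltac:(intros; apply HA0; lia) ltac:(lia)).
  rewrite HAcol in H0 by lia. simpl in H0. lra.
Qed.

Lemma push_phi_nonneg t i : (i < N)%nat -> 0 <= phi t i.
Proof.
  revert i; induction t as [|t IH]; intros i Hi.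
  - rewrite Hphi0 by exact Hi. lra.
  - rewrite HphiS by exact Hi. apply rsum_nonneg; intros j Hj.
    apply Rmult_le_pos; [now apply HA0 | now apply IH].
Qed.

Lemma push_phi_sum t : rsum N (phi t) = INR N.
Proof.
  induction t as [|t IH].
  - rewrite (rsum_ext N _ (fun _ => 1) Hphi0), rsum_const. ring.
  - rewrite (rsum_ext N _ _ (HphiS t)), rsum_swap, <- IH. apply rsum_ext; intros j Hj.
    rewrite rsum_scal_r, HAcol by exact Hj. ring.
Qed.

Lemma push_phi_le t i : (i < N)%nat -> phi t i <= INR N.
Proof.
  intros Hi. rewrite <- (push_phi_sum t).
  apply rsum_term_le; [intros; now apply push_phi_nonneg | exact Hi].
Qed.

Lemma push_phi_reach t s j i :
  (j < N)%nat -> reach edge t s j i -> kappa ^ s * phi t j <= phi (t + s)%nat i.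
Proof.
  intros Hj H. induction H as [|s j i i' _ IH Hi].
  - rewrite Nat.add_0_r. simpl. lra.
  - rewrite Nat.add_succ_r. destruct (Hedge _ _ _ Hi) as (Hi0 & Hi' & Hk).
    rewrite HphiS by exact Hi'.
    apply Rle_trans with (A (t + s)%nat i' i * phi (t + s)%nat i).
    + simpl. specialize (IH Hj). pose proof (push_phi_nonneg (t + s) i Hi0). nra.
    + apply (rsum_term_le N (fun j => A (t + s)%nat i' j * phi (t + s)%nat j)); [|exact Hi0].
      intros k Hk'. apply Rmult_le_pos; [now apply HA0 | now apply push_phi_nonneg].
Qed.

(** The total mass [N] is conserved, so at time [t - Tw] some agent holds at least 1, and a fraction
    [kappa ^ Tw] of it reaches [i]. For [t < Tw], the initial mass 1 kept through the self-loop
    suffices, since [kappa <= 1]. *)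
Lemma push_phi_lower t i : (i < N)%nat -> kappa ^ Tw <= phi t i.
Proof.
  intros Hi. pose proof push_kappa_le_1.
  destruct (Nat.le_gt_cases Tw t) as [Ht|Ht].
  - assert (Hj : exists j, (j < N)%nat /\ 1 <= phi (t - Tw)%nat j).
    { apply Classical_Prop.NNPP. intros Hno.
      assert (Hlt : forall n, (0 < n <= N)%nat -> rsum n (phi (t - Tw)%nat) < INR n).
      { induction n as [|n IH]; intros Hn; [lia|].
        assert (phi (t - Tw)%nat n < 1).
        { apply Rnot_le_lt. intros Hle. apply Hno. exists n. split; [lia | exact Hle]. }
        rewrite S_INR. simpl rsum. destruct n as [|n]; [simpl; lra|].
        specialize (IH ltac:(lia)). lra. }
      specialize (Hlt N ltac:(lia)). rewrite push_phi_sum in Hlt. lra. }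
    destruct Hj as (j & Hj & Hphi).
    pose proof (push_phi_reach (t - Tw) Tw j i Hj (Hreach _ _ _ Hj Hi)) as H1.
    replace (t - Tw + Tw)%nat with t in H1 by lia.
    pose proof (pow_lt kappa Tw Hkappa). nra.
  - pose proof (push_phi_reach 0 t i i Hi (reach_loop edge 0 t i (fun u => Hloop u i Hi))) as H1.
    rewrite Hphi0 in H1 by exact Hi. simpl in H1.
    apply Rle_trans with (kappa ^ t); [|lra].
    replace Tw with (t + (Tw - t))%nat by lia. rewrite pow_add.
    assert (kappa ^ (Tw - t) <= 1).
    { rewrite <- (pow1 (Tw - t)). apply pow_incr. lra. }
    pose proof (pow_lt kappa t Hkappa). nra.
Qed.

Lemma push_phi_pos t i : (i < N)%nat -> 0 < phi t i.
Proof.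
  intros Hi. eapply Rlt_le_trans; [apply (pow_lt kappa Tw Hkappa) | now apply push_phi_lower].
Qed.

Definition push_weight (t i j : nat) : R := A t i j * phi t j / phi (S t) i.

Lemma push_weight_nonneg t i j : (i < N)%nat -> (j < N)%nat -> 0 <= push_weight t i j.
Proof.
  intros Hi Hj. apply Rle_mult_inv_pos; [|now apply push_phi_pos].
  apply Rmult_le_pos; [now apply HA0 | now apply push_phi_nonneg].
Qed.

Lemma push_weight_sum t i : (i < N)%nat -> rsum N (push_weight t i) = 1.
Proof.
  intros Hi. unfold push_weight, Rdiv. rewrite rsum_scal_r, <- HphiS by exact Hi.
  apply Rinv_r. pose proof (push_phi_pos (S t) i Hi). lra.
Qed.

(** In the bound, [kappa] comes from the entry of [A], [kappa ^ Tw] from the lower bound on [phi] in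
    the numerator, and [INR N] from the upper bound on [phi] in the denominator. *)
Lemma push_weight_edge t j i : edge t j i -> kappa * kappa ^ Tw / INR N <= push_weight t i j.
Proof.
  intros He. destruct (Hedge _ _ _ He) as (Hj & Hi & Hk). unfold push_weight, Rdiv.
  pose proof (push_phi_pos (S t) i Hi). pose proof (push_phi_le (S t) i Hi).
  pose proof (push_phi_lower t j Hj). pose proof (pow_lt kappa Tw Hkappa).
  apply Rmult_le_compat.
  - nra.
  - left. apply Rinv_0_lt_compat. lra.
  - apply Rmult_le_compat; lra.
  - apply Rinv_le_contravar; lra.
Qed.

Lemma push_weight_bound_range : 0 < kappa * kappa ^ Tw / INR N <= 1.
Proof.
  pose proof (pow_lt kappa Tw Hkappa).
  assert (0 < INR N) by (apply lt_0_INR; lia).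
  split; [apply Rdiv_lt_0_compat; nra|].
  apply Rle_trans with (push_weight 0 0 0); [apply push_weight_edge, Hloop; lia|].
  rewrite <- (push_weight_sum 0 0) by lia.
  apply (rsum_term_le N (push_weight 0 0)); [intros; apply push_weight_nonneg|]; lia.
Qed.

End PushSum.

(** * Spread of a vector and delayed contractions *)

(** The base value [z 0] is itself an entry when [n > 0], so it does not disturb the maximum. In
    [spread], the second term is minus the minimum. *)
Fixpoint vmax (n : nat) (z : nat -> R) : R :=
  match n with O => z 0%nat | S m => Rmax (vmax m z) (z m) end.

Definition spread (n : nat) (z : nat -> R) : R := vmax n z + vmax n (fun i => - z i).

Lemma vmax_ge n z i : (i < n)%nat -> z i <= vmax n z.
Proof.
  induction n as [|n IH]; intros Hi; [lia|]. simpl.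
  destruct (Nat.eq_dec i n) as [->|]; [apply Rmax_r|].
  eapply Rle_trans; [apply IH; lia | apply Rmax_l].
Qed.

Lemma vmax_le n z M : (0 < n)%nat -> (forall i, (i < n)%nat -> z i <= M) -> vmax n z <= M.
Proof.
  intros Hn H.
  assert (Hm : forall m, (m <= n)%nat -> vmax m z <= M).
  { induction m as [|m IH]; intros Hm; simpl; [now apply H|].
    apply Rmax_lub; [apply IH | apply H]; lia. }
  now apply Hm.
Qed.

Lemma spread_ge n z i j : (i < n)%nat -> (j < n)%nat -> z i - z j <= spread n z.
Proof.
  intros Hi Hj. unfold spread.
  pose proof (vmax_ge n z i Hi). pose proof (vmax_ge n (fun i => - z i) j Hj). simpl in *. lra.
Qed.

Lemma spread_abs n z i j : (i < n)%nat -> (j < n)%nat -> Rabs (z i - z j) <= spread n z.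
Proof.
  intros Hi Hj. apply Rabs_le.
  pose proof (spread_ge n z i j Hi Hj). pose proof (spread_ge n z j i Hj Hi). lra.
Qed.

Lemma spread_nonneg n z : (0 < n)%nat -> 0 <= spread n z.
Proof. intros Hn. pose proof (spread_ge n z 0 0 Hn Hn). lra. Qed.

Lemma spread_le n z m M :
  (0 < n)%nat -> (forall i, (i < n)%nat -> m <= z i <= M) -> spread n z <= M - m.
Proof.
  intros Hn H. unfold spread.
  pose proof (vmax_le n z M Hn ltac:(intros; now apply H)).
  pose proof (vmax_le n (fun i => - z i) (- m) Hn
                ltac:(intros i Hi; specialize (H i Hi); lra)). lra.
Qed.

Lemma spread_opp n z : spread n (fun i => - z i) = spread n z.
Proof.
  unfold spread. rewrite Rplus_comm. f_equal.
  induction n as [|n IH]; simpl; rewrite ?IH, ?Ropp_involutive; reflexivity.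
Qed.

(** The deviation is the average of the differences [z i - z j]. It serves for the weights [pw] of
    the global average as well as for the rows of [W]. *)
Lemma weighted_abs_dev n (w z : nat -> R) i :
  (forall j, (j < n)%nat -> 0 <= w j) -> rsum n w = 1 -> (i < n)%nat ->
  Rabs (z i - rsum n (fun j => w j * z j)) <= spread n z.
Proof.
  intros Hw HW Hi.
  replace (z i - rsum n (fun j => w j * z j)) with (rsum n (fun j => w j * (z i - z j))).
  - eapply Rle_trans; [apply rsum_abs|].
    rewrite <- (Rmult_1_l (spread n z)), <- HW, <- rsum_scal_r.
    apply rsum_le; intros j Hj. rewrite Rabs_mult, (Rabs_pos_eq (w j)) by now apply Hw.
    apply Rmult_le_compat_l; [now apply Hw | now apply spread_abs].
  - rewrite (rsum_ext n _ (fun j => w j * z i - w j * z j)) by (intros; ring).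
    rewrite rsum_minus, rsum_scal_r, HW. ring.
Qed.

(** Above a common lower bound [c], the excess of entry [i] survives averaging in proportion to its
    weight. *)
Lemma weighted_lower n (w v : nat -> R) c i :
  (forall j, (j < n)%nat -> 0 <= w j) -> rsum n w = 1 -> (i < n)%nat ->
  (forall j, (j < n)%nat -> c <= v j) ->
  c + w i * (v i - c) <= rsum n (fun j => w j * v j).
Proof.
  intros Hw HW Hi Hv.
  replace (rsum n (fun j => w j * v j)) with (c + rsum n (fun j => w j * (v j - c))).
  - apply Rplus_le_compat_l.
    apply (rsum_term_le n (fun j => w j * (v j - c))); [|exact Hi].
    intros j Hj. specialize (Hw j Hj). specialize (Hv j Hj). nra.
  - rewrite (rsum_ext n (fun j => w j * (v j - c)) (fun j => w j * v j - w j * c))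
      by (intros; ring).
    rewrite rsum_minus, rsum_scal_r, HW. ring.
Qed.

Lemma delayed_contraction_bounded (D : nat -> R) Tw q g :
  (0 < Tw)%nat -> 0 <= q < 1 -> (forall t, D (t + Tw)%nat <= q * D t + g) ->
  exists C, forall t, D t <= C.
Proof.
  intros HTw Hq H.
  destruct (uniform_bound Tw (fun t C => D t <= C)) as (C0 & HC0 & HC).
  { intros; lra. }
  { intros t _. exists (D t). lra. }
  (* [g / (1 - q)] is the fixed point of [D -> q * D + g]; any bound above it is preserved. *)
  set (C := Rmax C0 (g / (1 - q))). exists C.
  assert (Hg : g <= (1 - q) * C).
  { apply Rle_trans with ((1 - q) * (g / (1 - q))); [right; field; lra|].
    apply Rmult_le_compat_l; [lra | apply Rmax_r]. }
  intros t. induction t as [t IH] using (well_founded_induction Nat.lt_wf_0).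
  destruct (Nat.le_gt_cases Tw t) as [Ht|Ht].
  - specialize (H (t - Tw)%nat). replace (t - Tw + Tw)%nat with t in H by lia.
    specialize (IH (t - Tw)%nat ltac:(lia)). nra.
  - eapply Rle_trans; [now apply HC | apply Rmax_l].
Qed.

(** Summing the recursion, the term [q * rsum n a] is absorbed on the left; the first [Tw] terms,
    which it does not reach, are added apart. *)
Lemma delayed_contraction_summable (a g : nat -> R) Tw q :
  0 <= q < 1 -> (forall t, 0 <= a t) ->
  (forall t, a (Tw + t)%nat <= q * a t + g t) -> summable g -> summable a.
Proof.
  intros Hq Ha H [G HG]. exists ((rsum Tw a + G) / (1 - q)). intros n.
  pose proof (rsum_le_length n (Tw + n) a Ha ltac:(lia)) as H1.
  rewrite rsum_add_nat in H1.
  assert (H2 : rsum n (fun t => a (Tw + t)%nat) <= q * rsum n a + rsum n g).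
  { rewrite <- rsum_scal, <- rsum_plus. apply rsum_le; intros; apply H. }
  specialize (HG n).
  apply Rmult_le_reg_r with (1 - q); [lra|].
  unfold Rdiv. rewrite Rmult_assoc, Rinv_l by lra. nra.
Qed.

(** * Contraction of perturbed averaging *)

Section Averaging.

Context (N : nat) (edge : nat -> nat -> nat -> Prop) (W : nat -> nat -> nat -> R) (eta : R)
  (Tw : nat)
  (HN : (1 <= N)%nat) (Heta : 0 < eta <= 1) (HTw : (0 < Tw)%nat)
  (Hreach : forall t j i, (j < N)%nat -> (i < N)%nat -> reach edge t Tw j i)
  (Hedge : forall t j i, edge t j i -> (j < N)%nat /\ (i < N)%nat /\ eta <= W t i j)
  (HW0 : forall t i j, (i < N)%nat -> (j < N)%nat -> 0 <= W t i j)
  (HW1 : forall t i, (i < N)%nat -> rsum N (W t i) = 1).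

Definition averaging (z p : nat -> nat -> R) : Prop :=
  forall t i, (i < N)%nat -> z (S t) i = rsum N (fun j => W t i j * (z t j + p t j)).

Lemma averaging_opp z p :
  averaging z p -> averaging (fun t i => - z t i) (fun t i => - p t i).
Proof.
  intros H t i Hi. rewrite H by exact Hi.
  rewrite <- (Rmult_1_l (rsum N _)), Ropp_mult_distr_l, <- rsum_scal.
  apply rsum_ext; intros; ring.
Qed.

Lemma averaging_lower z p b t s m :
  averaging z p -> (forall t j, (j < N)%nat -> Rabs (p t j) <= b t) ->
  (forall i, (i < N)%nat -> m <= z t i) ->
  forall i, (i < N)%nat -> m - rsum s (fun u => b (t + u)%nat) <= z (t + s)%nat i.
Proof.
  intros Hz Hp Hm. induction s as [|s IH]; intros i Hi.
  - rewrite Nat.add_0_r. simpl. specialize (Hm i Hi). lra.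
  - rewrite Nat.add_succ_r, Hz by exact Hi. simpl rsum.
    set (c := m - (rsum s (fun u => b (t + u)%nat) + b (t + s)%nat)).
    assert (Hv : forall j, (j < N)%nat -> c <= z (t + s)%nat j + p (t + s)%nat j).
    { intros j Hj. specialize (IH j Hj). pose proof (Hp (t + s)%nat j Hj).
      pose proof (Rle_abs (- p (t + s)%nat j)). rewrite Rabs_Ropp in H0. unfold c. lra. }
    pose proof (weighted_lower N (W (t + s)%nat i) (fun j => z (t + s)%nat j + p (t + s)%nat j) c i
      ltac:(intros; now apply HW0) (HW1 _ _ Hi) Hi Hv) as H. simpl in H.
    specialize (Hv i Hi). pose proof (HW0 (t + s)%nat i i Hi Hi). nra.
Qed.

(** An excess [h] over the minimum [m] travels along the walk: each arc keeps at least the fraction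
    [eta] of it, and each iteration costs at most [b]. *)
Lemma averaging_reach_lower z p b t m h s j i :
  averaging z p -> (forall t j, (j < N)%nat -> Rabs (p t j) <= b t) ->
  (forall i, (i < N)%nat -> m <= z t i) ->
  reach edge t s j i -> 0 <= h -> m + h <= z t j ->
  m + eta ^ s * h - rsum s (fun u => b (t + u)%nat) <= z (t + s)%nat i.
Proof.
  intros Hz Hp Hm Hr Hh Hj. induction Hr as [|s j i i' _ IH Hi].
  - rewrite Nat.add_0_r. simpl. lra.
  - specialize (IH Hj). destruct (Hedge _ _ _ Hi) as (Hi0 & Hi' & HWi).
    rewrite Nat.add_succ_r, Hz by exact Hi'. simpl rsum.
    set (c := m - (rsum s (fun u => b (t + u)%nat) + b (t + s)%nat)).
    assert (Hpl : forall j, (j < N)%nat -> - b (t + s)%nat <= p (t + s)%nat j).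
    { intros k Hk. pose proof (Hp (t + s)%nat k Hk).
      pose proof (Rle_abs (- p (t + s)%nat k)). rewrite Rabs_Ropp in H0. lra. }
    assert (Hv : forall j, (j < N)%nat -> c <= z (t + s)%nat j + p (t + s)%nat j).
    { intros k Hk. pose proof (averaging_lower z p b t s m Hz Hp Hm k Hk).
      specialize (Hpl k Hk). unfold c. lra. }
    pose proof (weighted_lower N (W (t + s)%nat i') (fun j => z (t + s)%nat j + p (t + s)%nat j) c i
      ltac:(intros; now apply HW0) (HW1 _ _ Hi') Hi0 Hv) as H. simpl in H.
    specialize (Hpl i Hi0).
    assert (H1 : eta ^ s * h <= z (t + s)%nat i + p (t + s)%nat i - c) by (unfold c; lra).
    assert (H0 : 0 <= eta ^ s * h) by (apply Rmult_le_pos; [apply pow_le; lra | exact Hh]).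
    simpl. replace (m + eta * eta ^ s * h - (rsum s (fun u => b (t + u)%nat) + b (t + s)%nat))
      with (c + eta * (eta ^ s * h)) by (unfold c; ring).
    nra.
Qed.

(** If agent 0 lies above the midpoint of the range, its excess over the minimum, at least half the
    spread, reaches every agent within [Tw] iterations and lifts the minimum by [eta ^ Tw / 2] times
    the spread, while the maximum grows only by the perturbations. Otherwise the same argument
    applies to [- z]. The perturbations count twice, once at each end of the range. *)
Lemma averaging_contraction z p b t :
  averaging z p -> (forall t j, (j < N)%nat -> Rabs (p t j) <= b t) ->
  spread N (z (t + Tw)%nat)
    <= (1 - eta ^ Tw / 2) * spread N (z t) + 2 * rsum Tw (fun u => b (t + u)%nat).
Proof.
  assert (Hhalf : forall z p, averaging z p -> (forall t j, (j < N)%nat -> Rabs (p t j) <= b t) ->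
    (vmax N (z t) - vmax N (fun i => - z t i)) / 2 <= z t 0%nat ->
    spread N (z (t + Tw)%nat)
    <= (1 - eta ^ Tw / 2) * spread N (z t) + 2 * rsum Tw (fun u => b (t + u)%nat)).
  { clear z p. intros z p Hz Hp H0. set (Bt := rsum Tw (fun u => b (t + u)%nat)).
    pose proof (spread_nonneg N (z t) ltac:(lia)) as Hs.
    set (M := vmax N (z t)) in *. set (m := - vmax N (fun i => - z t i)).
    assert (Hsp : spread N (z t) = M - m) by (unfold spread, M, m; ring).
    assert (Hm : forall i, (i < N)%nat -> m <= z t i).
    { intros i Hi. pose proof (vmax_ge N (fun i => - z t i) i Hi). simpl in H. unfold m. lra. }
    assert (HM : forall i, (i < N)%nat -> - M <= - z t i).
    { intros i Hi. pose proof (vmax_ge N (z t) i Hi). fold M in H. lra. }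
    rewrite Hsp in *.
    replace ((1 - eta ^ Tw / 2) * (M - m) + 2 * Bt)
      with ((M + Bt) - (m + eta ^ Tw * ((M - m) / 2) - Bt)) by field.
    apply spread_le; [lia|]. intros i Hi. split.
    - apply (averaging_reach_lower z p b t m ((M - m) / 2) Tw 0%nat i Hz Hp Hm);
        [apply Hreach; lia | lra | unfold m in *; lra].
    - pose proof (averaging_lower (fun t i => - z t i) (fun t i => - p t i) b t Tw (- M)
        (averaging_opp z p Hz) ltac:(intros; cbv beta; rewrite Rabs_Ropp; now apply Hp) HM i Hi).
      simpl in H. fold Bt in H. lra. }
  intros Hz Hp.
  destruct (Rle_dec ((vmax N (z t) - vmax N (fun i => - z t i)) / 2) (z t 0%nat)) as [H|H].
  - now apply (Hhalf z p).
  - rewrite <- (spread_opp N (z t)), <- (spread_opp N (z (t + Tw)%nat)).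
    apply (Hhalf (fun t i => - z t i) (fun t i => - p t i)).
    + now apply averaging_opp.
    + intros; cbv beta; rewrite Rabs_Ropp; now apply Hp.
    + apply Rnot_le_lt in H.
      assert (Hopp : vmax N (fun i => - - z t i) = vmax N (z t)).
      { clear. induction N as [|n IH]; simpl; rewrite ?IH, ?Ropp_involutive; reflexivity. }
      rewrite Hopp. lra.
Qed.

Lemma averaging_rate_range : 0 <= 1 - eta ^ Tw / 2 < 1.
Proof.
  pose proof (pow_lt eta Tw ltac:(lra)).
  assert (eta ^ Tw <= 1) by (rewrite <- (pow1 Tw); apply pow_incr; lra). lra.
Qed.

Lemma averaging_spread_bounded z p beta :
  averaging z p -> (forall t j, (j < N)%nat -> Rabs (p t j) <= beta) ->
  exists C, forall t, spread N (z t) <= C.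
Proof.
  intros Hz Hp.
  apply (delayed_contraction_bounded (fun t => spread N (z t)) Tw (1 - eta ^ Tw / 2)
           (2 * (INR Tw * beta)) HTw averaging_rate_range).
  intros t. rewrite <- (rsum_const Tw beta).
  exact (averaging_contraction z p (fun _ => beta) t Hz Hp).
Qed.

Lemma averaging_spread_sqr_summable z p b :
  averaging z p -> (forall t j, (j < N)%nat -> Rabs (p t j) <= b t) ->
  summable (fun t => b t ^ 2) -> summable (fun t => spread N (z t) ^ 2).
Proof.
  intros Hz Hp Hb. pose proof averaging_rate_range as Hq.
  set (q := 1 - eta ^ Tw / 2) in *.
  apply (delayed_contraction_summable _
           (fun t => / (1 - q) * (2 * rsum Tw (fun u => b (u + t)%nat)) ^ 2) Tw q Hq).
  - intros t. apply pow2_ge_0.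
  - intros t. pose proof (averaging_contraction z p b t Hz Hp) as H. fold q in H.
    rewrite Nat.add_comm. rewrite (rsum_ext Tw (fun u => b (u + t)%nat) (fun u => b (t + u)%nat))
      by (intros; f_equal; lia).
    pose proof (spread_nonneg N (z (t + Tw)%nat) ltac:(lia)) as Hs'.
    set (D' := spread N (z (t + Tw)%nat)) in *. set (D := spread N (z t)) in *.
    set (g := 2 * rsum Tw (fun u => b (t + u)%nat)) in *.
    apply Rle_trans with ((q * D + g) ^ 2); [apply pow_incr; lra|].
    assert (Hi : 0 < / (1 - q)) by (apply Rinv_0_lt_compat; lra).
    (* Convexity of the square with weights [q] and [1 - q] at the points [D] and [g / (1 - q)]; the
       squared spreads thus contract with the same factor [q]. *)
    assert (Heq : q * D ^ 2 + / (1 - q) * g ^ 2 - (q * D + g) ^ 2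
                  = q / (1 - q) * ((1 - q) * D - g) ^ 2) by (field; lra).
    assert (0 <= q / (1 - q) * ((1 - q) * D - g) ^ 2).
    { apply Rmult_le_pos; [apply Rle_mult_inv_pos; lra | apply pow2_ge_0]. }
    lra.
  - apply summable_scal; [left; apply Rinv_0_lt_compat; lra|].
    apply summable_sqr_scal, summable_sqr_rsum.
    intros u _. exact (summable_shift (fun t => b t ^ 2) u ltac:(intros; apply pow2_ge_0) Hb).
Qed.

End Averaging.

(* While [u < eps] the increments of [u] are controlled by the summable [g * P]; a late visit to
   [u < eps / 2] would therefore never leave [u < eps], forcing [g] itself to be summable. *)
Lemma summable_decrease_escape (u g P : nat -> R) C c eps T0 :
  0 <= C -> 0 < c -> 0 < eps -> (forall t, 0 <= g t) -> (forall t, 0 <= P t) ->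
  (forall t, u (S t) <= u t + C * g t) ->
  summable (fun t => g t * P t) -> ~ summable g ->
  (forall t, (T0 <= t)%nat -> u t < eps -> c <= P t) ->
  exists T, forall t, (T <= t)%nat -> eps / 2 <= u t.
Proof.
  intros HC Hc Heps Hg HP Hu Hs Hns Hlow.
  assert (Ha : forall t, 0 <= g t * P t) by (intros; now apply Rmult_le_pos).
  (* While [u < eps], the total rise of [u] is at most [C / c] times a tail of [g * P]; a tail below
     [rho] keeps that rise within [eps / 2]. The [+ 1] covers [C = 0]. *)
  set (rho := c * eps / (2 * (C + 1))).
  destruct (summable_tail _ Ha Hs rho) as [T1 HT1].
  { apply Rdiv_lt_0_compat; nra. }
  exists (Nat.max T0 T1). intros t Ht. apply Rnot_lt_le. intros Hlt. apply Hns.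
  assert (Htail : forall n, rsum n (fun k => g (t + k)%nat * P (t + k)%nat) < rho).
  { intros n. eapply Rle_lt_trans; [|apply (HT1 (t - T1 + n)%nat)].
    rewrite rsum_add_nat.
    rewrite (rsum_ext n _ (fun k => g (T1 + (t - T1 + k))%nat * P (T1 + (t - T1 + k))%nat))
      by (intros; do 2 f_equal; lia).
    pose proof (rsum_nonneg (t - T1) (fun t0 => g (T1 + t0)%nat * P (T1 + t0)%nat)
                  ltac:(intros; apply Ha)). lra. }
  assert (Hstay : forall n, c * u (t + n)%nat
            <= c * u t + C * rsum n (fun k => g (t + k)%nat * P (t + k)%nat) /\ u (t + n)%nat < eps).
  { assert (Hlt' : forall n, c * u (t + n)%nat
              <= c * u t + C * rsum n (fun k => g (t + k)%nat * P (t + k)%nat) ->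
              u (t + n)%nat < eps).
    { intros n H. specialize (Htail n).
      assert (C * rsum n (fun k => g (t + k)%nat * P (t + k)%nat) <= c * (eps / 2)).
      { apply Rle_trans with ((C + 1) * rho); [|right; unfold rho; field; lra].
        pose proof (rsum_nonneg n (fun k => g (t + k)%nat * P (t + k)%nat)
                      ltac:(intros; apply Ha)). nra. }
      apply Rmult_lt_reg_l with c; [exact Hc|]. nra. }
    induction n as [|n [IH1 IH2]].
    - assert (H : c * u (t + 0)%nat
              <= c * u t + C * rsum 0 (fun k => g (t + k)%nat * P (t + k)%nat))
        by (rewrite Nat.add_0_r; simpl; lra).
      split; [exact H | now apply Hlt'].
    - assert (H : c * u (t + S n)%nat
              <= c * u t + C * rsum (S n) (fun k => g (t + k)%nat * P (t + k)%nat)).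
      { rewrite Nat.add_succ_r. simpl rsum. specialize (Hu (t + n)%nat).
        pose proof (Hlow (t + n)%nat ltac:(lia) IH2). pose proof (Hg (t + n)%nat).
        assert (C * g (t + n)%nat * c <= C * g (t + n)%nat * P (t + n)%nat)
          by (apply Rmult_le_compat_l; [now apply Rmult_le_pos | assumption]).
        nra. }
      split; [exact H | now apply Hlt']. }
  exists (rsum t g + rho / c). intros n.
  apply Rle_trans with (rsum (t + n) g); [apply rsum_le_length; [exact Hg | lia]|].
  rewrite rsum_add_nat. apply Rplus_le_compat_l.
  apply Rmult_le_reg_r with c; [exact Hc|].
  replace (rho / c * c) with rho by (field; lra).
  rewrite <- rsum_scal_r. eapply Rle_trans; [|left; apply (Htail n)].
  apply rsum_le; intros k Hk. apply Rmult_le_compat_l; [apply Hg|].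
  apply Hlow; [lia | apply Hstay].
Qed.

(** * The block-wise algorithm *)

Section Algorithm.

Context
  (N B d : nat)
  (K : nat -> vec -> Prop)
  (f : nat -> bvec -> R) (gf : nat -> bvec -> bvec) (Lf : nat -> R)
  (r : nat -> vec -> R)
  (E : nat -> nat -> Prop)
  (sel : nat -> nat -> nat)
  (A : nat -> nat -> nat -> nat -> R) (kappa : R)
  (tf : nat -> nat -> vec -> bvec -> R) (gtf : nat -> nat -> vec -> bvec -> vec)
  (tau : nat -> R)
  (gamma : nat -> R)
  (x : nat -> nat -> bvec) (y : nat -> nat -> bvec) (phi : nat -> nat -> nat -> R)
  (xt : nat -> nat -> vec)
  (HN : (1 <= N)%nat) (HB : (1 <= B)%nat)
  (HK : forall l, (l < B)%nat ->
          (exists z, K l z) /\ closed_vset d (K l) /\ convex_vset (K l))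
  (Hf_rel : forall i, (i < N)%nat -> forall u v, eqbv d B u v -> f i u = f i v)
  (Hf_C1 : forall i, (i < N)%nat -> C1_on_nbhd d B (inK B K) (f i) (gf i))
  (Hf_lip : forall i, (i < N)%nat -> lipschitz_on_b d B (inK B K) (gf i) (Lf i))
  (Hf_bnd : forall i, (i < N)%nat -> bounded_on_b d B (inK B K) (gf i))
  (Hr_rel : forall l, (l < B)%nat -> forall u v, eqv d u v -> r l u = r l v)
  (Hr_cvx : forall l, (l < B)%nat -> convex_fun (r l))
  (Hr_sub : forall l, (l < B)%nat -> bounded_subgrad_on d (K l) (r l))
  (HU : coercive_on d B (inK B K) (Uobj N B f r))
  (HE_loop : forall i, (i < N)%nat -> E i i)
  (HE_sc : strongly_connected N E)
  (Hsel_rng : forall t i, (i < N)%nat -> (sel t i < B)%nat)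
  (Hsel_cov : forall i, (i < N)%nat -> exists T, (0 < T)%nat /\
                forall t l, (l < B)%nat -> exists s, (s < T)%nat /\ sel (t + s)%nat i = l)
  (Hkappa : 0 < kappa)
  (HA_pos : forall l t i j, (l < B)%nat -> (i < N)%nat -> (j < N)%nat ->
              in_Elt N E sel t i l j -> kappa < A l t i j)
  (HA_zero : forall l t i j, (l < B)%nat -> (i < N)%nat -> (j < N)%nat ->
               ~ in_Elt N E sel t i l j -> A l t i j = 0)
  (HA_col : forall l t j, (l < B)%nat -> (j < N)%nat -> rsum N (fun i => A l t i j) = 1)
  (Htf_rel : forall i l, (i < N)%nat -> (l < B)%nat ->
               forall z z' w w', eqv d z z' -> eqbv d B w w' -> tf i l z w = tf i l z' w')
  (Htau : forall i, (i < N)%nat -> 0 < tau i)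
  (Htf_sc : forall i l, (i < N)%nat -> (l < B)%nat -> forall w, inK B K w ->
              strongly_convex_on d (K l) (fun z => tf i l z w) (tau i))
  (Htf_grad : forall i l, (i < N)%nat -> (l < B)%nat -> forall w, inK B K w ->
              forall z, K l z -> has_grad_v d (fun z => tf i l z w) (gtf i l z w) z)
  (Htf_cont : forall i l, (i < N)%nat -> (l < B)%nat -> forall w, inK B K w ->
              cont_on_v d (K l) (fun z => gtf i l z w))
  (Htf_cons : forall i l, (i < N)%nat -> (l < B)%nat -> forall w, inK B K w ->
              eqv d (gtf i l (w l) w) (gf i w l))
  (Htf_lip : forall i l, (i < N)%nat -> (l < B)%nat -> exists L, forall z, K l z ->
              forall w w', inK B K w -> inK B K w' ->
                normv d (vsub (gtf i l z w) (gtf i l z w')) <= L * normb d B (bsub w w'))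
  (Hg_pos : forall t, 0 < gamma t <= 1)
  (Hg_dec : forall t, gamma (S t) <= gamma t)
  (Hg_div : cv_infty (fun T => sum_f_R0 gamma T))
  (Hg_sq : exists s, infinite_sum (fun t => (gamma t)^2) s)
  (Hx0 : forall i, (i < N)%nat -> inK B K (x 0%nat i))
  (Hy0 : forall i, (i < N)%nat -> eqbv d B (y 0%nat i) (gf i (x 0%nat i)))
  (Hphi0 : forall i l, (i < N)%nat -> (l < B)%nat -> phi 0%nat i l = 1)
  (Hxt : forall t i, (i < N)%nat ->
           K (sel t i) (xt t i) /\
           forall z, K (sel t i) z ->
             hatf N d (tf i (sel t i)) (gf i) (sel t i) (xt t i) (x t i) (y t i (sel t i))
               + r (sel t i) (xt t i)
             <= hatf N d (tf i (sel t i)) (gf i) (sel t i) z (x t i) (y t i (sel t i))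
               + r (sel t i) z)
  (Hphi : forall t i l, (i < N)%nat -> (l < B)%nat ->
            phi (S t) i l = rsum N (fun j => A l t i j * phi t j l))
  (Hx : forall t i l k, (i < N)%nat -> (l < B)%nat -> (k < d)%nat ->
          x (S t) i l k =
          rsum N (fun j => A l t i j * phi t j l / phi (S t) i l
                           * (x t j l k + gamma t * dx x xt sel t j l k)))
  (Hy : forall t i l k, (i < N)%nat -> (l < B)%nat -> (k < d)%nat ->
          y (S t) i l k =
          rsum N (fun j => A l t i j / phi (S t) i l
                           * (phi t j l * y t j l k
                              + gf j (x (S t) j) l k - gf j (x t j) l k))).

Let HKc l (Hl : (l < B)%nat) : closed_vset d (K l) /\ convex_vset (K l) := proj2 (HK l Hl).
Let W (l t i j : nat) : R := A l t i j * phi t j l / phi (S t) i l.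
Let pw (t j l : nat) : R := / INR N * phi t j l.
(* Setting [Xt = x] on the blocks that are not selected gives [dx = Xt - x] on every block. *)
Let Xt (t j l : nat) : vec := if Nat.eqb (sel t j) l then xt t j else x t j l.
Let gF (z : bvec) (l : nat) : vec := fun k => rsum N (fun i => gf i z l k).
(** Disagreement of the agents, measured coordinate by coordinate because each coordinate obeys its
    own scalar averaging recursion. *)
Let ex (t : nat) : R := rsum B (fun l => rsum d (fun k => spread N (fun i => x t i l k))).
Let ey (t : nat) : R := rsum B (fun l => rsum d (fun k => spread N (fun i => y t i l k))).
Let s := sbar N phi x.

(** * Weights of the algorithm *)

Lemma INR_N_pos : 0 < INR N.
Proof. apply lt_0_INR; lia. Qed.

Lemma A_nonneg l t i j : (l < B)%nat -> (i < N)%nat -> (j < N)%nat -> 0 <= A l t i j.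
Proof.
  intros Hl Hi Hj. destruct (Classical_Prop.classic (in_Elt N E sel t i l j)) as [H|H].
  - pose proof (HA_pos l t i j Hl Hi Hj H). lra.
  - rewrite (HA_zero l t i j Hl Hi Hj H). lra.
Qed.

Lemma block_edge_loop l t i : (i < N)%nat -> block_edge N E sel l t i i.
Proof.
  intros Hi. split; [exact Hi|]. split; [exact Hi|]. split; [now apply HE_loop | now right].
Qed.

Lemma block_edge_A l t j i : (l < B)%nat -> block_edge N E sel l t j i ->
  (j < N)%nat /\ (i < N)%nat /\ kappa < A l t i j.
Proof. intros Hl (Hj & Hi & He). auto. Qed.

Lemma block_reach l : (l < B)%nat -> exists T, (0 < T)%nat /\
  forall t j i, (j < N)%nat -> (i < N)%nat -> reach (block_edge N E sel l) t T j i.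
Proof.
  intros Hl. apply block_edge_reach_uniform; auto.
  intros i Hi. destruct (Hsel_cov i Hi) as (T & HT & H). exists T. split; [exact HT|]. auto.
Qed.

(** The bound of each block depends on its own reaching time. As [uniform_bound] combines upper
    bounds, it is applied to reciprocals. *)
Lemma phi_lower : exists c, 0 < c /\
  forall l t i, (l < B)%nat -> (i < N)%nat -> c <= phi t i l.
Proof.
  destruct (uniform_bound B (fun l C => 0 < C /\ forall t i, (i < N)%nat -> / C <= phi t i l))
    as (C & HC0 & HC).
  - intros l C C' HCC [HC H]. split; [lra|]. intros t i Hi.
    apply Rle_trans with (/ C); [apply Rinv_le_contravar; lra | now apply H].
  - intros l Hl. destruct (block_reach l Hl) as (T & _ & HT).
    exists (/ kappa ^ T). pose proof (pow_lt kappa T Hkappa).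
    split; [now apply Rinv_0_lt_compat|]. intros t i Hi. rewrite Rinv_inv.
    apply (push_phi_lower N (block_edge N E sel l) (A l) kappa (fun t i => phi t i l) T); auto.
    + intros; now apply block_edge_loop.
    + intros; now apply block_edge_A.
    + intros; now apply A_nonneg.
  - destruct (HC 0%nat ltac:(lia)) as [HCp _]. exists (/ C).
    split; [now apply Rinv_0_lt_compat|]. intros l t i Hl Hi. now apply HC.
Qed.

Lemma phi_pos t i l : (i < N)%nat -> (l < B)%nat -> 0 < phi t i l.
Proof.
  intros Hi Hl. destruct phi_lower as (c & Hc & H). specialize (H l t i Hl Hi). lra.
Qed.

Lemma phi_sum t l : (l < B)%nat -> rsum N (fun i => phi t i l) = INR N.
Proof.
  intros Hl. apply (push_phi_sum N (A l) (fun t i => phi t i l)); auto.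
Qed.

Lemma phi_le t i l : (i < N)%nat -> (l < B)%nat -> phi t i l <= INR N.
Proof.
  intros Hi Hl. rewrite <- (phi_sum t l Hl).
  apply (rsum_term_le N (fun i => phi t i l)); [|exact Hi].
  intros j Hj. left. now apply phi_pos.
Qed.

Lemma pw_nonneg t j l : (j < N)%nat -> (l < B)%nat -> 0 <= pw t j l.
Proof.
  intros Hj Hl. apply Rmult_le_pos; left; [apply Rinv_0_lt_compat, INR_N_pos | now apply phi_pos].
Qed.

Lemma pw_le_1 t j l : (j < N)%nat -> (l < B)%nat -> pw t j l <= 1.
Proof.
  intros Hj Hl. unfold pw. rewrite <- (Rinv_l (INR N)) by (pose proof INR_N_pos; lra).
  apply Rmult_le_compat_l; [left; apply Rinv_0_lt_compat, INR_N_pos | now apply phi_le].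
Qed.

Lemma pw_sum t l : (l < B)%nat -> rsum N (fun j => pw t j l) = 1.
Proof.
  intros Hl. unfold pw. rewrite rsum_scal, phi_sum by exact Hl.
  apply Rinv_l. pose proof INR_N_pos. lra.
Qed.

Lemma W_nonneg l t i j : (l < B)%nat -> (i < N)%nat -> (j < N)%nat -> 0 <= W l t i j.
Proof.
  intros Hl Hi Hj. apply Rle_mult_inv_pos; [|now apply phi_pos].
  apply Rmult_le_pos; [now apply A_nonneg | left; now apply phi_pos].
Qed.

Lemma W_sum l t i : (l < B)%nat -> (i < N)%nat -> rsum N (W l t i) = 1.
Proof.
  intros Hl Hi. unfold W, Rdiv. rewrite rsum_scal_r, <- Hphi by assumption.
  apply Rinv_r. pose proof (phi_pos (S t) i l Hi Hl). lra.
Qed.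

Lemma W_network l : (l < B)%nat -> exists Tw eta, 0 < eta <= 1 /\ (0 < Tw)%nat /\
  (forall t j i, (j < N)%nat -> (i < N)%nat -> reach (block_edge N E sel l) t Tw j i) /\
  (forall t j i, block_edge N E sel l t j i -> (j < N)%nat /\ (i < N)%nat /\ eta <= W l t i j).
Proof.
  intros Hl. destruct (block_reach l Hl) as (T & HT & Hr).
  exists T, (kappa * kappa ^ T / INR N). split; [|split; [exact HT|split; [exact Hr|]]].
  - apply (push_weight_bound_range N (block_edge N E sel l) (A l) kappa (fun t i => phi t i l) T);
      auto; intros; [now apply block_edge_loop | now apply block_edge_A | now apply A_nonneg].
  - intros t j i He. destruct (block_edge_A l t j i Hl He) as (Hj & Hi & _).
    split; [exact Hj|]. split; [exact Hi|].
    apply (push_weight_edge N (block_edge N E sel l) (A l) kappa (fun t i => phi t i l) T);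
      auto; intros; [now apply block_edge_loop | now apply block_edge_A | now apply A_nonneg].
Qed.

Lemma block_spread_bounded l z p beta :
  (l < B)%nat -> averaging N (W l) z p ->
  (forall t j, (j < N)%nat -> Rabs (p t j) <= beta) ->
  exists C, forall t, spread N (z t) <= C.
Proof.
  intros Hl Hz Hp. destruct (W_network l Hl) as (T & eta & Heta & HT & Hr & He).
  apply (averaging_spread_bounded N (block_edge N E sel l) (W l) eta T) with p beta; auto.
  - intros; now apply W_nonneg.
  - intros; now apply W_sum.
Qed.

Lemma block_spread_sqr_summable l z p b :
  (l < B)%nat -> averaging N (W l) z p ->
  (forall t j, (j < N)%nat -> Rabs (p t j) <= b t) ->
  summable (fun t => b t ^ 2) -> summable (fun t => spread N (z t) ^ 2).
Proof.
  intros Hl Hz Hp Hb. destruct (W_network l Hl) as (T & eta & Heta & HT & Hr & He).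
  apply (averaging_spread_sqr_summable N (block_edge N E sel l) (W l) eta T) with p b; auto.
  - intros; now apply W_nonneg.
  - intros; now apply W_sum.
Qed.

(** * Feasibility and the weighted average *)

Lemma dx_Xt t j l k : dx x xt sel t j l k = Xt t j l k - x t j l k.
Proof.
  unfold dx, Xt. destruct (Nat.eqb (sel t j) l); unfold vsub, vzero; ring.
Qed.

Lemma Xt_mem t j l : inK B K (x t j) -> (j < N)%nat -> (l < B)%nat -> K l (Xt t j l).
Proof.
  intros Hxj Hj Hl. unfold Xt. destruct (Nat.eqb_spec (sel t j) l) as [<-|].
  - now apply Hxt.
  - now apply Hxj.
Qed.

(** As [gamma t <= 1], each agent's intermediate point lies on the segment from [x] to [Xt], and [W]
    takes convex combinations of these points. *)
Lemma x_mem t i : (i < N)%nat -> inK B K (x t i).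
Proof.
  revert i. induction t as [|t IH]; intros i Hi; [now apply Hx0|].
  intros l Hl. destruct (HKc l Hl) as [Hcl Hcv].
  set (v := fun j => vadd (vscal (gamma t) (Xt t j l)) (vscal (1 - gamma t) (x t j l))).
  apply closed_vset_ext with (d := d) (u := fun k => rsum N (fun j => W l t i j * v j k));
    [exact Hcl| |].
  - apply (convex_comb_mem d (K l) N (W l t i) v Hcl Hcv).
    + intros; now apply W_nonneg.
    + now apply W_sum.
    + intros j Hj. pose proof (Hg_pos t). apply Hcv; [|now apply IH|lra].
      apply Xt_mem; auto.
  - intros k Hk. rewrite Hx by assumption. apply rsum_ext; intros j Hj.
    rewrite dx_Xt. unfold v, W, vadd, vscal. ring.
Qed.

Lemma sbar_pw t l k : s t l k = rsum N (fun j => pw t j l * x t j l k).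
Proof.
  unfold s, sbar, pw. rewrite <- rsum_scal. apply rsum_ext; intros; ring.
Qed.

Lemma sbar_mem t : inK B K (s t).
Proof.
  intros l Hl. destruct (HKc l Hl) as [Hcl Hcv].
  apply closed_vset_ext with (d := d) (u := fun k => rsum N (fun j => pw t j l * x t j l k));
    [exact Hcl| |].
  - apply (convex_comb_mem d (K l) N (fun j => pw t j l) (fun j => x t j l) Hcl Hcv).
    + intros; now apply pw_nonneg.
    + now apply pw_sum.
    + intros; now apply x_mem.
  - intros k _. now rewrite sbar_pw.
Qed.

(** The weight [phi (S t) i l] cancels the denominator of [W], and the columns of [A] sum to 1:
    mixing leaves [phi]-weighted means unchanged. *)
Lemma phi_weighted_sum (u : nat -> R) t l :
  (l < B)%nat ->
  rsum N (fun i => pw (S t) i l * rsum N (fun j => W l t i j * u j)) = rsum N (fun j => pw t j l * u j).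
Proof.
  intros Hl.
  transitivity (rsum N (fun i => rsum N (fun j => A l t i j * (pw t j l * u j)))).
  - apply rsum_ext; intros i Hi. rewrite <- rsum_scal. apply rsum_ext; intros j Hj.
    pose proof INR_N_pos. pose proof (phi_pos (S t) i l Hi Hl).
    unfold pw, W. field. lra.
  - rewrite rsum_swap. apply rsum_ext; intros j Hj.
    rewrite rsum_scal_r, HA_col by assumption. ring.
Qed.

Lemma sbar_step t l k : (l < B)%nat -> (k < d)%nat ->
  s (S t) l k = s t l k + gamma t * rsum N (fun j => pw t j l * dx x xt sel t j l k).
Proof.
  intros Hl Hk. rewrite !sbar_pw.
  rewrite (rsum_ext N _ (fun i => pw (S t) i l *
      rsum N (fun j => W l t i j * (x t j l k + gamma t * dx x xt sel t j l k)))).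
  - rewrite phi_weighted_sum by exact Hl. rewrite <- rsum_scal, <- rsum_plus.
    apply rsum_ext; intros; ring.
  - intros i Hi. now rewrite Hx.
Qed.

Lemma sbar_step_convex t l k : (l < B)%nat -> (k < d)%nat ->
  s (S t) l k = (1 - gamma t) * s t l k + gamma t * rsum N (fun j => pw t j l * Xt t j l k).
Proof.
  intros Hl Hk. rewrite sbar_step by assumption.
  rewrite (rsum_ext N (fun j => pw t j l * dx x xt sel t j l k)
             (fun j => pw t j l * Xt t j l k - pw t j l * x t j l k)).
  - rewrite rsum_minus, <- sbar_pw. ring.
  - intros j _. rewrite dx_Xt. ring.
Qed.

(** * Gradient tracking *)

(** In the update of [y] the gradient increment is not multiplied by [phi t j l], so it appears
    divided by it once the weights are those of [W]. *)
Lemma y_averaging l k : (l < B)%nat -> (k < d)%nat ->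
  averaging N (W l) (fun t i => y t i l k)
    (fun t j => (gf j (x (S t) j) l k - gf j (x t j) l k) / phi t j l).
Proof.
  intros Hl Hk t i Hi. rewrite Hy by assumption. apply rsum_ext; intros j Hj.
  unfold W. field. pose proof (phi_pos t j l Hj Hl). pose proof (phi_pos (S t) i l Hi Hl). lra.
Qed.

(** True at the start because [phi] is 1 and [y] is the local gradient; afterwards mixing preserves
    the mean and the gradient increments telescope. *)
Lemma y_tracking t l k : (l < B)%nat -> (k < d)%nat ->
  rsum N (fun i => pw t i l * y t i l k) = / INR N * rsum N (fun i => gf i (x t i) l k).
Proof.
  intros Hl Hk. induction t as [|t IH].
  - rewrite <- rsum_scal. apply rsum_ext; intros i Hi. unfold pw.
    rewrite Hphi0, (Hy0 i Hi l Hl k Hk) by assumption. ring.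
  - rewrite (rsum_ext N _ (fun i => pw (S t) i l * rsum N (fun j => W l t i j *
        (y t j l k + (gf j (x (S t) j) l k - gf j (x t j) l k) / phi t j l)))).
    + rewrite phi_weighted_sum by exact Hl.
      transitivity (rsum N (fun j => pw t j l * y t j l k) +
        / INR N * rsum N (fun j => gf j (x (S t) j) l k - gf j (x t j) l k)).
      * rewrite <- rsum_scal, <- rsum_plus. apply rsum_ext; intros j Hj. unfold pw. field.
        pose proof (phi_pos t j l Hj Hl). pose proof INR_N_pos. lra.
      * rewrite IH, rsum_minus. ring.
    + intros i Hi. f_equal. exact (y_averaging l k Hl Hk t i Hi).
Qed.

Lemma ex_nonneg t : 0 <= ex t.
Proof.
  apply rsum_nonneg; intros l _. apply rsum_nonneg; intros k _. apply spread_nonneg; lia.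
Qed.

Lemma ey_nonneg t : 0 <= ey t.
Proof.
  apply rsum_nonneg; intros l _. apply rsum_nonneg; intros k _. apply spread_nonneg; lia.
Qed.

Lemma x_sbar_dist t i : (i < N)%nat -> normb d B (bsub (x t i) (s t)) <= ex t.
Proof.
  intros Hi. eapply Rle_trans; [apply normb_le_sum|].
  apply rsum_le; intros l Hl. apply rsum_le; intros k Hk.
  unfold bsub. rewrite sbar_pw.
  apply (weighted_abs_dev N (fun j => pw t j l) (fun j => x t j l k)).
  - intros; now apply pw_nonneg.
  - now apply pw_sum.
  - exact Hi.
Qed.

Lemma y_grad_dist t i l : (i < N)%nat -> (l < B)%nat ->
  normv d (vsub (vscal (INR N) (y t i l)) (fun k => rsum N (fun i => gf i (x t i) l k)))
    <= INR N * ey t.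
Proof.
  intros Hi Hl. pose proof INR_N_pos.
  set (ybar := fun k => rsum N (fun i => pw t i l * y t i l k)).
  rewrite (normv_ext d _ (vscal (INR N) (vsub (y t i l) ybar))).
  - rewrite normv_scal, Rabs_pos_eq by lra. apply Rmult_le_compat_l; [lra|].
    eapply Rle_trans; [apply normv_le_sum|].
    apply Rle_trans with (rsum d (fun k => spread N (fun i => y t i l k))).
    + apply rsum_le; intros k Hk.
      apply (weighted_abs_dev N (fun j => pw t j l) (fun j => y t j l k)).
      * intros; now apply pw_nonneg.
      * now apply pw_sum.
      * exact Hi.
    + apply (rsum_term_le B (fun l => rsum d (fun k => spread N (fun i => y t i l k)))); [|exact Hl].
      intros; apply rsum_nonneg; intros; apply spread_nonneg; lia.
  - intros k Hk. unfold vsub, vscal, ybar. rewrite y_tracking by assumption. field. lra.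
Qed.

Lemma gf_lipschitz_uniform : exists L, 0 <= L /\
  forall i, (i < N)%nat -> lipschitz_on_b d B (inK B K) (gf i) L.
Proof.
  apply uniform_bound.
  - intros i C C' HC H u v Hu Hv. eapply Rle_trans; [now apply H|].
    apply Rmult_le_compat_r; [apply normb_nonneg | exact HC].
  - intros i Hi. exists (Lf i). now apply Hf_lip.
Qed.

Lemma gf_bounded_uniform : exists M, 0 <= M /\
  forall i, (i < N)%nat -> forall u, inK B K u -> normb d B (gf i u) <= M.
Proof.
  apply uniform_bound.
  - intros i C C' HC H u Hu. specialize (H u Hu). lra.
  - intros i Hi. now apply Hf_bnd.
Qed.

Lemma r_lipschitz_uniform : exists L, 0 <= L /\
  forall l, (l < B)%nat -> forall u v, K l u -> K l v -> r l u - r l v <= L * normv d (vsub u v).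
Proof.
  apply uniform_bound.
  - intros l C C' HC H u v Hu Hv. eapply Rle_trans; [now apply H|].
    apply Rmult_le_compat_r; [apply normv_nonneg | exact HC].
  - intros l Hl. apply convex_lipschitz_on; auto.
Qed.

Lemma gf_coord_bounded : exists M, 0 <= M /\ forall i u l k,
  (i < N)%nat -> inK B K u -> (l < B)%nat -> (k < d)%nat -> Rabs (gf i u l k) <= M.
Proof.
  destruct gf_bounded_uniform as (M & HM0 & HM). exists M. split; [exact HM0|].
  intros i u l k Hi Hu Hl Hk. eapply Rle_trans; [apply (normv_coord d (gf i u l) k Hk)|].
  eapply Rle_trans; [apply (normb_block d B (gf i u) l Hl)|]. now apply HM.
Qed.

(** The deviation from the mean obeys an averaging recursion with perturbations at most
    [(M + M) / c], and the mean is bounded by tracking. No knowledge of the steps enters. *)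
Lemma y_bounded : exists M, 0 <= M /\ forall t i l, (i < N)%nat -> (l < B)%nat ->
  normv d (y t i l) <= M.
Proof.
  destruct gf_coord_bounded as (M & HM0 & HM). destruct phi_lower as (c & Hc & Hphic).
  pose proof INR_N_pos as HNp.
  destruct (uniform_bound B (fun l C => forall t i, (i < N)%nat -> normv d (y t i l) <= C))
    as (C & HC0 & HC).
  - intros l C C' HCC H t i Hi. specialize (H t i Hi). lra.
  - intros l Hl.
    destruct (uniform_bound d (fun k C => forall t i, (i < N)%nat -> Rabs (y t i l k) <= C))
      as (C & HC0 & HC).
    + intros k C C' HCC H t i Hi. specialize (H t i Hi). lra.
    + intros k Hk.
      destruct (block_spread_bounded l (fun t i => y t i l k) _ ((M + M) / c) Hl
                  (y_averaging l k Hl Hk)) as [C HC].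
      * intros t j Hj. unfold Rdiv. rewrite Rabs_mult, Rabs_inv.
        pose proof (phi_pos t j l Hj Hl). rewrite (Rabs_pos_eq (phi t j l)) by lra.
        apply Rmult_le_compat; [apply Rabs_pos | left; now apply Rinv_0_lt_compat | |].
        -- eapply Rle_trans; [apply Rabs_triang|]. rewrite Rabs_Ropp.
           apply Rplus_le_compat; apply HM; auto; now apply x_mem.
        -- apply Rinv_le_contravar; [exact Hc | now apply Hphic].
      * exists (C + M). intros t i Hi.
        replace (y t i l k) with ((y t i l k - rsum N (fun j => pw t j l * y t j l k))
          + rsum N (fun j => pw t j l * y t j l k)) by ring.
        eapply Rle_trans; [apply Rabs_triang|]. apply Rplus_le_compat.
        -- eapply Rle_trans; [|apply (HC t)].
           apply (weighted_abs_dev N (fun j => pw t j l) (fun j => y t j l k)); [|now apply pw_sum|exact Hi].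
           intros; now apply pw_nonneg.
        -- rewrite y_tracking, Rabs_mult by assumption.
           rewrite Rabs_pos_eq by (left; now apply Rinv_0_lt_compat).
           apply Rmult_le_reg_l with (INR N); [exact HNp|].
           rewrite <- Rmult_assoc, Rinv_r, Rmult_1_l by lra.
           eapply Rle_trans; [apply rsum_abs|]. rewrite <- rsum_const.
           apply rsum_le; intros j Hj. apply HM; auto. now apply x_mem.
    + exists (INR d * C). intros t i Hi. eapply Rle_trans; [apply normv_le_sum|].
      rewrite <- rsum_const. apply rsum_le; intros k Hk. now apply HC.
  - exists C. split; [exact HC0|]. intros t i l Hi Hl. now apply HC.
Qed.

(** * Bounded steps and square summable disagreement *)

(** The minimizer is compared with the current point. The surrogate's gradient there is [gf], which
    cancels the correction in [hatf] and leaves [N * y]. On a block that is not selected both sides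
    are 0. *)
Lemma best_response_descent t j l : (j < N)%nat -> (l < B)%nat ->
  ipv d (vscal (INR N) (y t j l)) (vsub (Xt t j l) (x t j l)) + (r l (Xt t j l) - r l (x t j l))
    <= - (tau j / 2) * normv d (vsub (Xt t j l) (x t j l)) ^ 2.
Proof.
  intros Hj Hl. pose proof (x_mem t j Hj) as Hxj. unfold Xt.
  destruct (Nat.eqb_spec (sel t j) l) as [Hs|_].
  - destruct (Hxt t j Hj) as [Hm Hmin]. rewrite Hs in *. specialize (Hmin (x t j l) (Hxj l Hl)).
    pose proof (strongly_convex_lower_bound d (K l) (fun z => tf j l z (x t j)) (tau j)
      (gtf j l (x t j l) (x t j)) (x t j l) (xt t j)
      ltac:(intros; apply Htf_rel; auto; intros ? _ ? _; reflexivity)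
      (Htf_sc j l Hj Hl _ Hxj) (Htf_grad j l Hj Hl _ Hxj _ (Hxj l Hl)) (Hxj l Hl) Hm) as H.
    rewrite (ipv_ext d (gtf j l (x t j l) (x t j)) (gf j (x t j) l)
               (vsub (xt t j) (x t j l)) (vsub (xt t j) (x t j l))) in H
      by (try (intros ? _; reflexivity); now apply Htf_cons).
    unfold hatf in Hmin. rewrite !ipv_sub_l in Hmin.
    assert (H0 : forall u, ipv d u (vsub (x t j l) (x t j l)) = 0) by (intros; rewrite ipv_sub_r; ring).
    rewrite !H0 in Hmin. lra.
  - rewrite (ipv_ext d _ (vscal (INR N) (y t j l)) (vsub (x t j l) (x t j l)) (vscal 0 vzero)),
      ipv_scal_r; [|intros ? _; reflexivity | intros k _; unfold vsub, vscal, vzero; ring].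
    rewrite (normv_ext d (vsub (x t j l) (x t j l)) vzero), normv_vzero;
      [lra | intros k _; unfold vsub, vzero; ring].
Qed.

(** The descent bound is quadratic in the step, while the linear term and the variation of [r] are
    at most linear in it. *)
Lemma step_bounded : exists M, 0 <= M /\ forall t j l, (j < N)%nat -> (l < B)%nat ->
  normv d (vsub (Xt t j l) (x t j l)) <= M.
Proof.
  destruct y_bounded as (My & HMy0 & HMy). destruct r_lipschitz_uniform as (Lr & HLr0 & HLr).
  pose proof INR_N_pos.
  destruct (uniform_bound N (fun j M => forall t l, (l < B)%nat ->
              normv d (vsub (Xt t j l) (x t j l)) <= M)) as (M & HM0 & HM).
  - intros j C C' HC H' t l Hl. specialize (H' t l Hl). lra.
  - intros j Hj. exists ((INR N * My + Lr) / (tau j / 2)). intros t l Hl.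
    pose proof (Htau j Hj) as Ht. pose proof (best_response_descent t j l Hj Hl) as H1.
    pose proof (x_mem t j Hj) as Hxj.
    pose proof (HLr l Hl (x t j l) (Xt t j l) (Hxj l Hl) (Xt_mem t j l Hxj Hj Hl)) as H2.
    rewrite normv_sub_sym in H2.
    set (v := vsub (Xt t j l) (x t j l)) in *.
    pose proof (ipv_CS_abs d (vscal (INR N) (y t j l)) v) as H3.
    rewrite normv_scal, (Rabs_pos_eq (INR N)) in H3 by lra.
    pose proof (Rle_abs (- ipv d (vscal (INR N) (y t j l)) v)) as H4. rewrite Rabs_Ropp in H4.
    pose proof (HMy t j l Hj Hl). pose proof (normv_nonneg d v) as Hn.
    assert (H5 : tau j / 2 * normv d v ^ 2 <= (INR N * My + Lr) * normv d v).
    { assert (INR N * normv d (y t j l) * normv d v <= INR N * My * normv d v).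
      { apply Rmult_le_compat_r; [exact Hn|]. apply Rmult_le_compat_l; lra. }
      lra. }
    apply Rmult_le_reg_r with (tau j / 2); [lra|].
    replace ((INR N * My + Lr) / (tau j / 2) * (tau j / 2)) with (INR N * My + Lr) by (field; lra).
    destruct (Rle_lt_or_eq_dec 0 (normv d v) Hn) as [Hp|<-].
    + apply Rmult_le_reg_r with (normv d v); [exact Hp|]. simpl in H5. lra.
    + rewrite Rmult_0_l. nra.
  - exists M. split; [exact HM0|]. intros t j l Hj Hl. now apply HM.
Qed.

Lemma gamma_sqr_summable : summable (fun t => gamma t ^ 2).
Proof.
  destruct Hg_sq as [c Hc]. exists c. intros n.
  apply Rle_trans with (rsum (S n) (fun t => gamma t ^ 2)).
  - simpl. pose proof (pow2_ge_0 (gamma n)). simpl in *. lra.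
  - rewrite rsum_sum_f_R0. apply sum_incr; [exact Hc | intros; apply pow2_ge_0].
Qed.

Lemma x_averaging l k : (l < B)%nat -> (k < d)%nat ->
  averaging N (W l) (fun t i => x t i l k) (fun t j => gamma t * (Xt t j l k - x t j l k)).
Proof.
  intros Hl Hk t i Hi. rewrite Hx by assumption. apply rsum_ext; intros j _.
  now rewrite dx_Xt.
Qed.

Lemma ex_sqr_summable : summable (fun t => ex t ^ 2).
Proof.
  destruct step_bounded as (M & HM0 & HM).
  apply (summable_sqr_rsum B (fun l t => rsum d (fun k => spread N (fun i => x t i l k)))).
  intros l Hl. apply (summable_sqr_rsum d (fun k t => spread N (fun i => x t i l k))).
  intros k Hk.
  apply (block_spread_sqr_summable l (fun t i => x t i l k) _ (fun t => M * gamma t) Hl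
           (x_averaging l k Hl Hk)).
  - intros t j Hj. pose proof (Hg_pos t). rewrite Rabs_mult, Rabs_pos_eq, Rmult_comm by lra.
    apply Rmult_le_compat_r; [lra|].
    eapply Rle_trans; [apply (normv_coord d (vsub (Xt t j l) (x t j l)) k Hk) | now apply HM].
  - apply summable_sqr_scal, gamma_sqr_summable.
Qed.

(** An agent's move splits into the pull of its neighbours, bounded coordinatewise by the spread,
    and the average of the steps, of order [gamma]. *)
Lemma x_step_bound : exists C, 0 <= C /\ forall t i, (i < N)%nat ->
  normb d B (bsub (x (S t) i) (x t i)) <= ex t + C * gamma t.
Proof.
  destruct step_bounded as (M & HM0 & HM). exists (INR B * (INR d * M)).
  split; [repeat apply Rmult_le_pos; auto using pos_INR|].
  intros t i Hi. pose proof (Hg_pos t).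
  eapply Rle_trans; [apply normb_le_sum|].
  replace (ex t + INR B * (INR d * M) * gamma t)
    with (rsum B (fun l => rsum d (fun k => spread N (fun i => x t i l k) + M * gamma t))).
  - apply rsum_le; intros l Hl. apply rsum_le; intros k Hk.
    unfold bsub. rewrite (x_averaging l k Hl Hk t i Hi).
    rewrite (rsum_ext N _ (fun j => W l t i j * x t j l k
               + W l t i j * (gamma t * (Xt t j l k - x t j l k)))) by (intros; ring).
    rewrite rsum_plus.
    replace (rsum N (fun j => W l t i j * x t j l k) +
             rsum N (fun j => W l t i j * (gamma t * (Xt t j l k - x t j l k))) - x t i l k)
      with (- (x t i l k - rsum N (fun j => W l t i j * x t j l k)) +
             rsum N (fun j => W l t i j * (gamma t * (Xt t j l k - x t j l k)))) by ring.
    eapply Rle_trans; [apply Rabs_triang|]. rewrite Rabs_Ropp. apply Rplus_le_compat.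
    + apply (weighted_abs_dev N (W l t i) (fun j => x t j l k)); [|now apply W_sum|exact Hi].
      intros; now apply W_nonneg.
    + eapply Rle_trans; [apply rsum_abs|].
      rewrite <- (Rmult_1_l (M * gamma t)), <- (W_sum l t i Hl Hi), <- rsum_scal_r.
      apply rsum_le; intros j Hj. pose proof (W_nonneg l t i j Hl Hi Hj).
      rewrite Rabs_mult, (Rabs_pos_eq (W l t i j)) by lra. apply Rmult_le_compat_l; [lra|].
      rewrite Rabs_mult, Rabs_pos_eq, Rmult_comm by lra. apply Rmult_le_compat_r; [lra|].
      eapply Rle_trans; [apply (normv_coord d (vsub (Xt t j l) (x t j l)) k Hk) | now apply HM].
  - unfold ex.
    rewrite (rsum_ext B _ (fun l => rsum d (fun k => spread N (fun i => x t i l k))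
                                    + INR d * (M * gamma t))).
    + rewrite rsum_plus, rsum_const. ring.
    + intros l _. now rewrite rsum_plus, rsum_const.
Qed.

Lemma ey_sqr_summable : summable (fun t => ey t ^ 2).
Proof.
  destruct x_step_bound as (C & HC0 & HC). destruct gf_lipschitz_uniform as (L & HL0 & HL).
  destruct phi_lower as (c & Hc & Hphic).
  apply (summable_sqr_rsum B (fun l t => rsum d (fun k => spread N (fun i => y t i l k)))).
  intros l Hl. apply (summable_sqr_rsum d (fun k t => spread N (fun i => y t i l k))).
  intros k Hk.
  apply (block_spread_sqr_summable l (fun t i => y t i l k) _
           (fun t => (/ c * L) * (ex t + C * gamma t)) Hl (y_averaging l k Hl Hk)).
  - intros t j Hj. unfold Rdiv. rewrite Rabs_mult, Rabs_inv.
    pose proof (phi_pos t j l Hj Hl). rewrite (Rabs_pos_eq (phi t j l)) by lra.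
    rewrite Rmult_comm, Rmult_assoc.
    apply Rmult_le_compat; [left; now apply Rinv_0_lt_compat | apply Rabs_pos | |].
    + apply Rinv_le_contravar; [exact Hc | now apply Hphic].
    + eapply Rle_trans; [apply (normv_coord d (bsub (gf j (x (S t) j)) (gf j (x t j)) l) k Hk)|].
      eapply Rle_trans; [apply (normb_block d B _ l Hl)|].
      eapply Rle_trans; [apply HL; auto; now apply x_mem|].
      apply Rmult_le_compat_l; [exact HL0 | now apply HC].
  - apply summable_sqr_scal, summable_sqr_plus; [apply ex_sqr_summable|].
    apply summable_sqr_scal, gamma_sqr_summable.
Qed.

Lemma consensus i : (i < N)%nat -> Un_cv (fun t => normb d B (bsub (x t i) (s t))) 0.
Proof.
  intros Hi eps Heps.
  destruct (summable_sqr_lim0 ex ex_nonneg ex_sqr_summable eps Heps) as [T HT].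
  exists T. intros t Ht. unfold Rdist.
  rewrite Rminus_0_r, Rabs_pos_eq by apply normb_nonneg.
  eapply Rle_lt_trans; [now apply x_sbar_dist | now apply HT].
Qed.

(* Only the step of agent 0 is followed: it selects every block infinitely often. *)
Let delta (t : nat) : R := normv d (vsub (xt t 0%nat) (x t 0%nat (sel t 0%nat))) ^ 2.
Let U := Uobj N B f r.

(** * Descent of the objective *)

Lemma f_has_grad i u : (i < N)%nat -> inK B K u -> has_grad_b d B (f i) (gf i u) u.
Proof. intros Hi Hu. destruct (Hf_C1 i Hi) as (V & _ & HV & Hg & _). auto. Qed.

Lemma sbar_step_norm : exists C, 0 <= C /\ forall t,
  normb d B (bsub (s (S t)) (s t)) <= C * gamma t.
Proof.
  destruct step_bounded as (M & HM0 & HM). exists (INR B * (INR d * M)).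
  split; [repeat apply Rmult_le_pos; auto using pos_INR|].
  intros t. pose proof (Hg_pos t). eapply Rle_trans; [apply normb_le_sum|].
  rewrite Rmult_assoc, Rmult_assoc, <- rsum_const, <- (rsum_const d).
  apply rsum_le; intros l Hl. apply rsum_le; intros k Hk.
  unfold bsub. rewrite sbar_step by assumption.
  replace (s t l k + gamma t * rsum N (fun j => pw t j l * dx x xt sel t j l k) - s t l k)
    with (gamma t * rsum N (fun j => pw t j l * dx x xt sel t j l k)) by ring.
  rewrite Rabs_mult, Rabs_pos_eq, Rmult_comm by lra. apply Rmult_le_compat_r; [lra|].
  eapply Rle_trans; [apply rsum_abs|].
  rewrite <- (Rmult_1_l M), <- (pw_sum t l Hl), <- rsum_scal_r.
  apply rsum_le; intros j Hj. pose proof (pw_nonneg t j l Hj Hl).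
  rewrite Rabs_mult, (Rabs_pos_eq (pw t j l)) by lra. apply Rmult_le_compat_l; [lra|].
  rewrite dx_Xt.
  eapply Rle_trans; [apply (normv_coord d (vsub (Xt t j l) (x t j l)) k Hk) | now apply HM].
Qed.

Lemma gF_lipschitz L u v l : (forall i, (i < N)%nat -> lipschitz_on_b d B (inK B K) (gf i) L) ->
  inK B K u -> inK B K v -> (l < B)%nat ->
  normv d (vsub (gF u l) (gF v l)) <= INR N * (L * normb d B (bsub u v)).
Proof.
  intros HL Hu Hv Hl. rewrite <- rsum_const.
  rewrite (normv_ext d _ (fun k => rsum N (fun i => bsub (gf i u) (gf i v) l k))).
  - eapply Rle_trans; [apply (normv_rsum d N (fun i => bsub (gf i u) (gf i v) l))|].
    apply rsum_le; intros i Hi.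
    eapply Rle_trans; [apply (normb_block d B _ l Hl) | now apply HL].
  - intros k _. unfold vsub, gF, bsub. now rewrite rsum_minus.
Qed.

Lemma y_gF_dist L t i l : 0 <= L ->
  (forall i, (i < N)%nat -> lipschitz_on_b d B (inK B K) (gf i) L) ->
  (i < N)%nat -> (l < B)%nat ->
  normv d (vsub (vscal (INR N) (y t i l)) (gF (s t) l)) <= INR N * ey t + INR N * (L * ex t).
Proof.
  intros HL0 HL Hi Hl.
  eapply Rle_trans; [apply normv_sub_triang with (v := fun k => rsum N (fun i => gf i (x t i) l k))|].
  apply Rplus_le_compat; [now apply y_grad_dist|].
  rewrite <- rsum_const.
  rewrite (normv_ext d _ (fun k => rsum N (fun i => bsub (gf i (x t i)) (gf i (s t)) l k))).
  - eapply Rle_trans; [apply (normv_rsum d N (fun i => bsub (gf i (x t i)) (gf i (s t)) l))|].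
    apply rsum_le; intros j Hj.
    eapply Rle_trans; [apply (normb_block d B _ l Hl)|].
    eapply Rle_trans; [apply HL; [exact Hj | now apply x_mem | apply sbar_mem]|].
    apply Rmult_le_compat_l; [exact HL0 | now apply x_sbar_dist].
  - intros k _. unfold vsub, gF, bsub. now rewrite rsum_minus.
Qed.

Lemma smooth_step L t : 0 <= L ->
  (forall i, (i < N)%nat -> lipschitz_on_b d B (inK B K) (gf i) L) ->
  rsum N (fun i => f i (s (S t))) <= rsum N (fun i => f i (s t))
    + gamma t * rsum B (fun l => rsum N (fun j =>
        pw t j l * ipv d (gF (s t) l) (vsub (Xt t j l) (x t j l))))
    + INR N * (L * normb d B (bsub (s (S t)) (s t)) ^ 2).
Proof.
  intros HL0 HL.
  replace (gamma t * rsum B (fun l => rsum N (fun j =>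
        pw t j l * ipv d (gF (s t) l) (vsub (Xt t j l) (x t j l)))))
    with (rsum N (fun i => ipb d B (gf i (s t)) (bsub (s (S t)) (s t)))).
  - rewrite <- rsum_const, <- !rsum_plus. apply rsum_le; intros i Hi.
    apply (descent_lemma d B K (f i) (gf i) L); auto using sbar_mem.
    intros u Hu. now apply f_has_grad.
  - unfold ipb. rewrite rsum_swap, <- rsum_scal. apply rsum_ext; intros l Hl.
    rewrite <- (ipv_rsum_l d N (fun i => gf i (s t) l)). fold (gF (s t) l).
    transitivity (ipv d (gF (s t) l)
      (fun k => rsum N (fun j => vscal (gamma t * pw t j l) (vsub (Xt t j l) (x t j l)) k))).
    + apply ipv_ext; intros k Hk; [reflexivity|]. unfold bsub.
      rewrite sbar_step, <- rsum_scal by assumption. unfold Rminus.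
      rewrite (Rplus_comm (s t l k)), Rplus_assoc, Rplus_opp_r, Rplus_0_r.
      apply rsum_ext; intros j _. rewrite dx_Xt. unfold vscal, vsub. ring.
    + rewrite ipv_rsum_r, <- rsum_scal. apply rsum_ext; intros j _.
      rewrite ipv_scal_r. ring.
Qed.

(** Convexity is used twice: between the old average and the mean [P] of the [Xt], and within [P] by
    Jensen. Replacing [r] at the average by [r] at the agents' points costs [Lr * ex t]. *)
Lemma nonsmooth_step Lr t l : 0 <= Lr -> (l < B)%nat ->
  (forall u v, K l u -> K l v -> r l u - r l v <= Lr * normv d (vsub u v)) ->
  r l (s (S t) l) <= r l (s t l)
    + gamma t * rsum N (fun j => pw t j l * (r l (Xt t j l) - r l (x t j l) + Lr * ex t)).
Proof.
  intros HLr0 Hl HLr. pose proof (Hg_pos t) as Hg.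
  set (P := (fun k => rsum N (fun j => pw t j l * Xt t j l k)) : vec).
  assert (HJ : r l P <= rsum N (fun j => pw t j l * r l (Xt t j l))).
  { apply (jensen d (r l) N (fun j => pw t j l) (fun j => Xt t j l)); auto.
    - intros; now apply pw_nonneg.
    - now apply pw_sum. }
  pose proof (Hr_cvx l Hl P (s t l) (gamma t) ltac:(lra)) as H1.
  rewrite (Hr_rel l Hl _ (s (S t) l)) in H1.
  2:{ intros k Hk. rewrite sbar_step_convex by assumption. unfold vadd, vscal, P. ring. }
  assert (H2 : rsum N (fun j => pw t j l * r l (Xt t j l)) - r l (s t l)
    <= rsum N (fun j => pw t j l * (r l (Xt t j l) - r l (x t j l) + Lr * ex t))).
  { replace (r l (s t l)) with (rsum N (fun j => pw t j l * r l (s t l)))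
      by (rewrite rsum_scal_r, pw_sum by exact Hl; ring).
    rewrite <- rsum_minus. apply rsum_le; intros j Hj.
    pose proof (pw_nonneg t j l Hj Hl).
    assert (r l (x t j l) - r l (s t l) <= Lr * ex t).
    { eapply Rle_trans; [apply HLr; [now apply x_mem | now apply sbar_mem]|].
      apply Rmult_le_compat_l; [exact HLr0|].
      eapply Rle_trans; [apply (normb_block d B (bsub (x t j) (s t)) l Hl) | now apply x_sbar_dist]. }
    nra. }
  nra.
Qed.

(** The gradient at the average is replaced by [N * y], at the price of the tracking error times the
    bounded step; each agent's own descent inequality then applies. Of the resulting decrease only
    the term of agent 0 is kept. *)
Lemma objective_step : exists c C, 0 < c /\ 0 <= C /\ forall t,
  U (s (S t)) <= U (s t) - c * (gamma t * delta t) + C * (gamma t * (ex t + ey t) + gamma t ^ 2).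
Proof.
  destruct step_bounded as (M & HM0 & HM). destruct r_lipschitz_uniform as (Lr & HLr0 & HLr).
  destruct gf_lipschitz_uniform as (L & HL0 & HL). destruct phi_lower as (c & Hc & Hphic).
  destruct sbar_step_norm as (Cs & HCs0 & HCs).
  pose proof INR_N_pos as HNp. pose proof (Htau 0%nat ltac:(lia)) as Ht0.
  (* The three terms are the price of [ey] in the tracking error, of [ex] in it through the
     gradients, and of [ex] through [r]. *)
  set (C1 := M * INR N + M * (INR N * L) + Lr).
  assert (HC1 : 0 <= C1) by (unfold C1; repeat apply Rplus_le_le_0_compat;
    repeat apply Rmult_le_pos; lra).
  exists (/ INR N * c * (tau 0%nat / 2)), (INR B * (INR N * C1) + INR N * (L * Cs ^ 2)).
  split; [|split].
  - pose proof (Rinv_0_lt_compat _ HNp). apply Rmult_lt_0_compat; [apply Rmult_lt_0_compat|]; lra.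
  - pose proof (pos_INR B). pose proof (pow2_ge_0 Cs).
    apply Rplus_le_le_0_compat; (apply Rmult_le_pos; [lra|]; apply Rmult_le_pos; lra).
  - intros t. pose proof (Hg_pos t) as Hg. pose proof (ex_nonneg t) as Hex. pose proof (ey_nonneg t) as Hey.
    set (e := ex t + ey t).
    assert (Hterm : forall l j, (l < B)%nat -> (j < N)%nat ->
      pw t j l * ipv d (gF (s t) l) (vsub (Xt t j l) (x t j l))
      + pw t j l * (r l (Xt t j l) - r l (x t j l) + Lr * ex t)
      <= C1 * e - pw t j l * (tau j / 2 * normv d (vsub (Xt t j l) (x t j l)) ^ 2)).
    { intros l j Hl Hj. pose proof (pw_nonneg t j l Hj Hl). pose proof (pw_le_1 t j l Hj Hl).
      pose proof (best_response_descent t j l Hj Hl) as H1.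
      specialize (HM t j l Hj Hl). set (v := vsub (Xt t j l) (x t j l)) in *.
      pose proof (y_gF_dist L t j l HL0 HL Hj Hl) as H2.
      pose proof (ipv_CS d (vsub (gF (s t) l) (vscal (INR N) (y t j l))) v) as H3.
      rewrite ipv_sub_l, normv_sub_sym in H3.
      assert (H4 : normv d (vsub (vscal (INR N) (y t j l)) (gF (s t) l)) * normv d v
                   <= (INR N * ey t + INR N * (L * ex t)) * M)
        by (apply Rmult_le_compat; auto using normv_nonneg).
      assert (H5 : (INR N * ey t + INR N * (L * ex t)) * M + Lr * ex t <= C1 * e).
      { unfold C1, e.
        assert (0 <= M * INR N * ex t) by (repeat apply Rmult_le_pos; lra).
        assert (0 <= M * (INR N * L) * ey t) by (repeat apply Rmult_le_pos; lra).
        assert (0 <= Lr * ey t) by (repeat apply Rmult_le_pos; lra). lra. }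
      assert (H6 : 0 <= C1 * e) by (apply Rmult_le_pos; unfold e; lra).
      rewrite <- Rmult_plus_distr_l.
      apply Rle_trans with (pw t j l * (C1 * e - tau j / 2 * normv d v ^ 2)).
      - apply Rmult_le_compat_l; lra.
      - nra. }
    assert (Hdelta : / INR N * c * (tau 0%nat / 2) * delta t
      <= rsum B (fun l => rsum N (fun j =>
           pw t j l * (tau j / 2 * normv d (vsub (Xt t j l) (x t j l)) ^ 2)))).
    { set (l0 := sel t 0%nat). assert (Hl0 : (l0 < B)%nat) by (apply Hsel_rng; lia).
      assert (Hnn : forall l j, (l < B)%nat -> (j < N)%nat ->
        0 <= pw t j l * (tau j / 2 * normv d (vsub (Xt t j l) (x t j l)) ^ 2)).
      { intros l j Hl Hj. pose proof (pw_nonneg t j l Hj Hl). pose proof (Htau j Hj).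
        apply Rmult_le_pos; [assumption|]. apply Rmult_le_pos; [lra | apply pow2_ge_0]. }
      apply Rle_trans with (rsum N (fun j =>
           pw t j l0 * (tau j / 2 * normv d (vsub (Xt t j l0) (x t j l0)) ^ 2))).
      2:{ apply (rsum_term_le B (fun l => rsum N (fun j =>
           pw t j l * (tau j / 2 * normv d (vsub (Xt t j l) (x t j l)) ^ 2)))); [|exact Hl0].
          intros l Hl. apply rsum_nonneg; intros j Hj. now apply Hnn. }
      apply Rle_trans with (pw t 0%nat l0 * (tau 0%nat / 2 * normv d (vsub (Xt t 0%nat l0) (x t 0%nat l0)) ^ 2)).
      2:{ apply (rsum_term_le N (fun j => pw t j l0 * (tau j / 2 * normv d (vsub (Xt t j l0) (x t j l0)) ^ 2)));
          [intros j Hj; now apply Hnn | lia]. }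
      unfold delta, Xt. fold l0. rewrite Nat.eqb_refl.
      rewrite Rmult_assoc. apply Rmult_le_compat_r.
      - apply Rmult_le_pos; [lra | apply pow2_ge_0].
      - unfold pw. apply Rmult_le_compat_l; [left; now apply Rinv_0_lt_compat|]. apply Hphic; [exact Hl0 | lia]. }
    pose proof (smooth_step L t HL0 HL) as H1.
    assert (H2 : rsum B (fun l => r l (s (S t) l)) <= rsum B (fun l => r l (s t l))
      + gamma t * rsum B (fun l => rsum N (fun j =>
          pw t j l * (r l (Xt t j l) - r l (x t j l) + Lr * ex t)))).
    { rewrite <- rsum_scal, <- rsum_plus. apply rsum_le; intros l Hl.
      apply nonsmooth_step; auto. }
    assert (H3 : rsum B (fun l => rsum N (fun j =>
                   pw t j l * ipv d (gF (s t) l) (vsub (Xt t j l) (x t j l))))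
                 + rsum B (fun l => rsum N (fun j =>
                   pw t j l * (r l (Xt t j l) - r l (x t j l) + Lr * ex t)))
                 <= INR B * (INR N * (C1 * e)) - / INR N * c * (tau 0%nat / 2) * delta t).
    { eapply Rle_trans; [|apply Rplus_le_compat_l, Ropp_le_contravar, Hdelta].
      rewrite <- (rsum_const B), <- (rsum_const N).
      change (rsum B (fun _ => rsum N (fun _ => C1 * e))
        + - rsum B (fun l => rsum N (fun j => pw t j l * (tau j / 2 * normv d (vsub (Xt t j l) (x t j l)) ^ 2))))
        with (rsum B (fun _ => rsum N (fun _ => C1 * e))
        - rsum B (fun l => rsum N (fun j => pw t j l * (tau j / 2 * normv d (vsub (Xt t j l) (x t j l)) ^ 2)))).
      rewrite <- rsum_plus, <- rsum_minus. apply rsum_le; intros l Hl.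
      rewrite <- rsum_plus, <- rsum_minus. apply rsum_le; intros j Hj. now apply Hterm. }
    assert (H4 : INR N * (L * normb d B (bsub (s (S t)) (s t)) ^ 2)
                 <= INR N * (L * Cs ^ 2) * gamma t ^ 2).
    { replace (INR N * (L * Cs ^ 2) * gamma t ^ 2) with (INR N * (L * (Cs * gamma t) ^ 2)) by ring.
      repeat apply Rmult_le_compat_l; [lra | exact HL0|].
      apply pow_incr. split; [apply normb_nonneg | apply HCs]. }
    apply Rmult_le_compat_l with (r := gamma t) in H3; [|lra].
    assert (H5 : 0 <= INR B * (INR N * C1) * gamma t ^ 2)
      by (apply Rmult_le_pos; [|apply pow2_ge_0];
          apply Rmult_le_pos; [apply pos_INR | apply Rmult_le_pos; lra]).
    assert (H6 : 0 <= INR N * (L * Cs ^ 2) * (gamma t * e)).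
    { apply Rmult_le_pos; [|apply Rmult_le_pos; unfold e; lra].
      apply Rmult_le_pos; [lra | apply Rmult_le_pos; [exact HL0 | apply pow2_ge_0]]. }
    unfold U, Uobj. lra.
Qed.

Lemma U_lipschitz : exists C, 0 <= C /\ forall u v, inK B K u -> inK B K v ->
  U u - U v <= C * normb d B (bsub u v).
Proof.
  destruct r_lipschitz_uniform as (Lr & HLr0 & HLr). destruct gf_bounded_uniform as (M & HM0 & HM).
  exists (INR N * M + INR B * Lr).
  split; [apply Rplus_le_le_0_compat; apply Rmult_le_pos; auto using pos_INR|].
  intros u v Hu Hv. unfold U, Uobj.
  replace (rsum N (fun i => f i u) + rsum B (fun l => r l (u l))
           - (rsum N (fun i => f i v) + rsum B (fun l => r l (v l))))
    with (rsum N (fun i => f i u - f i v) + rsum B (fun l => r l (u l) - r l (v l)))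
    by (rewrite !rsum_minus; ring).
  rewrite Rmult_plus_distr_r, 2!Rmult_assoc, <- !rsum_const. apply Rplus_le_compat.
  - apply rsum_le; intros i Hi.
    apply (bounded_grad_lipschitz d B K (f i) (gf i)); auto.
    intros w Hw. now apply f_has_grad.
  - apply rsum_le; intros l Hl. eapply Rle_trans; [apply HLr; auto|].
    apply Rmult_le_compat_l; [exact HLr0 | apply (normb_block d B (bsub u v) l Hl)].
Qed.

(** Coercivity gives a lower bound outside a ball only; inside it, Lipschitz continuity on [K] gives
    one without any compactness argument. *)
Lemma U_bounded_below : exists m, forall u, inK B K u -> m <= U u.
Proof.
  destruct U_lipschitz as (C & HC0 & HC). destruct (HU 0) as [Rr HR].
  exists (Rmin 0 (U (s 0%nat) - C * (normb d B (s 0%nat) + Rr))). intros u Hu.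
  destruct (Rle_lt_dec Rr (normb d B u)) as [Hr|Hr].
  - eapply Rle_trans; [apply Rmin_l | now apply HR].
  - eapply Rle_trans; [apply Rmin_r|].
    pose proof (HC (s 0%nat) u (sbar_mem 0%nat) Hu).
    pose proof (normb_sub_le d B (s 0%nat) u).
    assert (C * normb d B (bsub (s 0%nat) u) <= C * (normb d B (s 0%nat) + Rr))
      by (apply Rmult_le_compat_l; lra).
    lra.
Qed.

Lemma objective_error_summable : summable (fun t => gamma t * (ex t + ey t) + gamma t ^ 2).
Proof.
  apply summable_plus; [|exact gamma_sqr_summable].
  apply summable_mul; [exact gamma_sqr_summable|].
  apply summable_sqr_plus; [exact ex_sqr_summable | exact ey_sqr_summable].
Qed.

Lemma delta_nonneg t : 0 <= delta t.
Proof. apply pow2_ge_0. Qed.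

Lemma objective_telescoped : exists c M, 0 < c /\ forall n,
  U (s n) + c * rsum n (fun t => gamma t * delta t) <= M.
Proof.
  destruct objective_step as (c & C & Hc & HC & H). destruct objective_error_summable as [G HG].
  exists c, (U (s 0%nat) + C * G). split; [exact Hc|]. intros n.
  apply Rle_trans with (U (s 0%nat) + C * rsum n (fun t => gamma t * (ex t + ey t) + gamma t ^ 2)).
  - induction n as [|n IH]; [simpl; lra|]. rewrite !rsum_S. specialize (H n). lra.
  - apply Rplus_le_compat_l, Rmult_le_compat_l; [exact HC | apply HG].
Qed.

Lemma gamma_delta_nonneg t : 0 <= gamma t * delta t.
Proof. pose proof (Hg_pos t). pose proof (delta_nonneg t). nra. Qed.

Lemma gamma_delta_summable : summable (fun t => gamma t * delta t).
Proof.
  destruct objective_telescoped as (c & M & Hc & H). destruct U_bounded_below as [m Hm].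
  exists ((M - m) / c). intros n. specialize (H n). specialize (Hm (s n) (sbar_mem n)).
  apply Rmult_le_reg_r with c; [exact Hc|].
  replace ((M - m) / c * c) with (M - m) by (field; lra). lra.
Qed.

(** The objective stays at most [M] along the averages, so they never enter the region where
    coercivity forces it to be at least [M + 1]. *)
Lemma sbar_bounded : exists M, forall t, normb d B (s t) <= M.
Proof.
  destruct objective_telescoped as (c & M & Hc & H). destruct (HU (M + 1)) as [Rr HR].
  exists Rr. intros t. apply Rnot_lt_le. intros Hlt.
  pose proof (HR (s t) (sbar_mem t) ltac:(lra)) as H1. specialize (H t).
  pose proof (rsum_nonneg t (fun t => gamma t * delta t) ltac:(intros; apply gamma_delta_nonneg)).
  unfold U in H. nra.
Qed.

(** * Stationarity of limit points *)

(** If the step were short, the minimizer [w] would be close to [xs l], and its variational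
    inequality tested at [z] would be the stationarity inequality at [xs] up to an error smaller
    than the violation [eta]. *)
Lemma step_lower_near_nonstationary xs l z :
  inK B K xs -> (l < B)%nat -> K l z ->
  ipv d (gF xs l) (vsub z (xs l)) + r l z - r l (xs l) < 0 ->
  exists eps del T, 0 < eps /\ 0 < del /\ forall t, (T <= t)%nat ->
    normb d B (bsub (s t) xs) < eps -> sel t 0%nat = l ->
    del <= normv d (vsub (xt t 0%nat) (x t 0%nat l)).
Proof.
  intros Hxs Hl Hz Hneg.
  assert (H0N : (0 < N)%nat) by lia.
  destruct gf_lipschitz_uniform as (L & HL0 & HL). destruct r_lipschitz_uniform as (Lr & HLr0 & HLr).
  destruct (Htf_lip 0%nat l H0N Hl) as [Lt0 HLt0].
  set (Lt := Rmax 0 Lt0). assert (HLtp : 0 <= Lt) by apply Rmax_l.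
  set (eta := - (ipv d (gF xs l) (vsub z (xs l)) + r l z - r l (xs l))).
  assert (Heta : 0 < eta) by (unfold eta; lra).
  set (Z := normv d (vsub z (xs l))). assert (HZ : 0 <= Z) by apply normv_nonneg.
  set (G0 := normv d (gF xs l)). assert (HG0 : 0 <= G0) by apply normv_nonneg.
  (* [e1] bounds the error in the gradient and [rho] the distance from [w] to [xs l]; each is chosen
     to consume at most a quarter of [eta]. *)
  set (e1 := eta / (4 * (Z + 1))). assert (He1 : 0 < e1) by (apply Rdiv_lt_0_compat; lra).
  set (rho := eta / (4 * (G0 + Lr + e1 + 1))).
  assert (Hrho : 0 < rho) by (apply Rdiv_lt_0_compat; lra).
  destruct (Htf_cont 0%nat l H0N Hl xs Hxs (xs l) (Hxs l Hl) (e1 / 4) ltac:(lra))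
    as (del & Hdel & Hcont).
  set (sig := Rmin del rho). assert (Hsig : 0 < sig) by now apply Rmin_glb_lt.
  pose proof INR_N_pos as HNp.
  set (K1 := Lt + L + INR N + INR N * L). 
  assert (HNL : 0 <= INR N * L) by (apply Rmult_le_pos; lra).
  assert (HK1 : 0 <= K1) by (unfold K1; lra).
  (* The agent is within [2 * e0] of [xs]: the first term keeps the Lipschitz errors, collected in
     [K1], below [e1 / 4], and the second leaves [sig / 2] for the step itself. *)
  set (e0 := Rmin (e1 / (8 * (K1 + 1))) (sig / 4)).
  assert (He0 : 0 < e0) by (apply Rmin_glb_lt; [apply Rdiv_lt_0_compat|]; lra).
  destruct (summable_sqr_lim0 ex ex_nonneg ex_sqr_summable e0 He0) as [T1 HT1].
  destruct (summable_sqr_lim0 ey ey_nonneg ey_sqr_summable e0 He0) as [T2 HT2].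
  exists e0, (sig / 2), (Nat.max T1 T2). split; [exact He0|]. split; [lra|].
  intros t Ht Hst Hsel. apply Rnot_lt_le. intros Hlt.
  specialize (HT1 t ltac:(lia)). specialize (HT2 t ltac:(lia)).
  assert (He0a : e0 <= e1 / (8 * (K1 + 1))) by apply Rmin_l.
  assert (He0b : e0 <= sig / 4) by apply Rmin_r.
  pose proof (x_mem t 0%nat H0N) as Hxm. set (xi := x t 0%nat) in *.
  set (w := xt t 0%nat) in *. set (yi := vscal (INR N) (y t 0%nat l)).
  destruct (Hxt t 0%nat H0N) as [Hw Hmin]. fold xi w in Hw, Hmin. rewrite Hsel in Hw, Hmin.
  assert (Hxx : normb d B (bsub xi xs) < 2 * e0).
  { pose proof (normb_sub_triang d B xi (s t) xs). pose proof (x_sbar_dist t 0%nat H0N).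
    fold xi in H0. lra. }
  assert (Hwx : normv d (vsub w (xs l)) < sig).
  { pose proof (normv_sub_triang d w (xi l) (xs l)).
    pose proof (normb_block d B (bsub xi xs) l Hl) as H1.
    change (bsub xi xs l) with (vsub (xi l) (xs l)) in H1. lra. }
  assert (Hsd : sig <= del) by apply Rmin_l. assert (Hsr : sig <= rho) by apply Rmin_r.
  pose proof (minimizer_variational_inequality d (K l) (fun u => tf 0%nat l u xi)
    (vsub yi (gf 0%nat xi l)) (xi l) (r l) (gtf 0%nat l w xi) w z
    ltac:(intros; apply Htf_rel; auto; intros ? _ ? _; reflexivity)
    (proj2 (HKc l Hl)) (Hr_cvx l Hl) (Htf_grad 0%nat l H0N Hl xi Hxm w Hw) Hw Hz Hmin) as HVI.
  set (p := vadd (gtf 0%nat l w xi) (vsub yi (gf 0%nat xi l))) in *.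
  set (v := vsub p (gF xs l)).
  assert (Hv : normv d v <= e1).
  (* [v1] moves the anchor of the surrogate to [xs] before [v2] moves its argument, so continuity in
     the argument is needed only at the anchor [xs]. Consistency there produces [v3]; [v4] is the
     tracking error and [v5] the change of the full gradient. *)
  { set (v1 := vsub (gtf 0%nat l w xi) (gtf 0%nat l w xs)).
    set (v2 := vsub (gtf 0%nat l w xs) (gtf 0%nat l (xs l) xs)).
    set (v3 := bsub (gf 0%nat xs) (gf 0%nat xi) l).
    set (v4 := vsub yi (gF (s t) l)).
    set (v5 := vsub (gF (s t) l) (gF xs l)).
    assert (Hdec : eqv d v (vadd v1 (vadd v2 (vadd v3 (vadd v4 v5))))).
    { intros k Hk. pose proof (Htf_cons 0%nat l H0N Hl xs Hxs k Hk) as Hc.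
      unfold v, p, v1, v2, v3, v4, v5, vadd, vsub, bsub. rewrite Hc. ring. }
    rewrite (normv_ext d _ _ Hdec).
    pose proof (normv_triang d v1 (vadd v2 (vadd v3 (vadd v4 v5)))).
    pose proof (normv_triang d v2 (vadd v3 (vadd v4 v5))).
    pose proof (normv_triang d v3 (vadd v4 v5)).
    pose proof (normv_triang d v4 v5).
    assert (N1 : normv d v1 <= Lt * (2 * e0)).
    { eapply Rle_trans; [apply (HLt0 w Hw xi xs Hxm Hxs)|].
      apply Rle_trans with (Lt * normb d B (bsub xi xs)).
      - apply Rmult_le_compat_r; [apply normb_nonneg | apply Rmax_r].
      - apply Rmult_le_compat_l; lra. }
    assert (N2 : normv d v2 < e1 / 4) by (apply Hcont; [exact Hw | lra]).
    assert (N3 : normv d v3 <= L * (2 * e0)).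
    { eapply Rle_trans; [apply (normb_block d B (bsub (gf 0%nat xs) (gf 0%nat xi)) l Hl)|].
      eapply Rle_trans; [apply HL; auto|]. rewrite normb_sub_sym.
      apply Rmult_le_compat_l; lra. }
    assert (N4 : normv d v4 <= INR N * e0 + INR N * L * e0).
    { eapply Rle_trans; [apply (y_gF_dist L t 0%nat l HL0 HL H0N Hl)|].
      rewrite Rmult_assoc. apply Rplus_le_compat; apply Rmult_le_compat_l; try lra.
      apply Rmult_le_compat_l; lra. }
    assert (N5 : normv d v5 <= INR N * L * e0).
    { eapply Rle_trans; [apply (gF_lipschitz L); auto using sbar_mem|].
      rewrite Rmult_assoc. repeat apply Rmult_le_compat_l; lra. }
    assert (HK1e : K1 * (2 * e0) <= e1 / 4).
    { apply Rle_trans with ((K1 + 1) * (2 * (e1 / (8 * (K1 + 1))))).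
      - apply Rmult_le_compat; lra.
      - right. field. lra. }
    unfold K1 in HK1e.
    assert (0 <= INR N * e0) by (apply Rmult_le_pos; lra).
    lra. }
  assert (Hp : ipv d p (vsub z w)
    = ipv d (gF xs l) (vsub z (xs l)) + ipv d (gF xs l) (vsub (xs l) w)
      + ipv d v (vsub z (xs l)) + ipv d v (vsub (xs l) w)).
  { unfold v. rewrite !ipv_sub_l, !ipv_sub_r. ring. }
  rewrite Hp in HVI.
  pose proof (ipv_CS d (gF xs l) (vsub (xs l) w)) as C1. fold G0 in C1.
  pose proof (ipv_CS d v (vsub z (xs l))) as C2. fold Z in C2.
  pose proof (ipv_CS d v (vsub (xs l) w)) as C3.
  pose proof (HLr l Hl (xs l) w (Hxs l Hl) Hw) as C4.
  rewrite (normv_sub_sym d (xs l) w) in C1, C3, C4.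
  set (q := normv d (vsub w (xs l))) in *. assert (Hq : 0 <= q) by apply normv_nonneg.
  assert (B1 : (G0 + Lr + e1) * q <= eta / 4).
  { apply Rle_trans with ((G0 + Lr + e1 + 1) * rho).
    - apply Rmult_le_compat; lra.
    - right. unfold rho. field. lra. }
  assert (B2 : normv d v * Z <= eta / 4).
  { apply Rle_trans with (e1 * (Z + 1)).
    - apply Rmult_le_compat; try lra. apply normv_nonneg.
    - right. unfold e1. field. lra. }
  assert (B3 : normv d v * q <= e1 * q) by (apply Rmult_le_compat_r; lra).
  unfold eta in *. lra.
Qed.

Lemma gamma_le_of_le a b : (a <= b)%nat -> gamma b <= gamma a.
Proof. induction 1 as [|b _ IH]; [lra|]. pose proof (Hg_dec b). lra. Qed.

Lemma sbar_drift C a j : 0 <= C ->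
  (forall t, normb d B (bsub (s (S t)) (s t)) <= C * gamma t) ->
  normb d B (bsub (s (a + j)%nat) (s a)) <= INR j * (C * gamma a).
Proof.
  intros HC H. induction j as [|j IH].
  - rewrite Nat.add_0_r, (normb_ext d B _ (fun l k => 0 * s a l k)).
    + rewrite normb_scal, Rabs_R0. simpl. lra.
    + intros l _ k _. unfold bsub. ring.
  - rewrite Nat.add_succ_r, S_INR.
    eapply Rle_trans; [apply normb_sub_triang with (y := s (a + j)%nat)|].
    specialize (H (a + j)%nat).
    assert (C * gamma (a + j)%nat <= C * gamma a)
      by (apply Rmult_le_compat_l; [exact HC | apply gamma_le_of_le; lia]).
    lra.
Qed.

Lemma gamma_shift_not_summable T : ~ summable (fun t => gamma (T + t)%nat).
Proof.
  intros [C HC]. destruct (Hg_div (rsum T gamma + C)) as [n Hn].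
  specialize (Hn (T + n)%nat ltac:(lia)). rewrite <- rsum_sum_f_R0 in Hn.
  rewrite <- Nat.add_succ_r, rsum_add_nat in Hn. specialize (HC (S n)). lra.
Qed.

Lemma limit_point_mem xs : limit_point d B s xs -> inK B K xs.
Proof.
  intros Hlim l Hl. apply (HKc l Hl). intros eps Heps.
  destruct (Hlim eps Heps 0%nat) as (t & _ & Ht). exists (s t l).
  split; [now apply sbar_mem|].
  eapply Rle_lt_trans; [apply (normb_block d B (bsub (s t) xs) l Hl) | exact Ht].
Qed.

(** The escape lemma is applied to the position at the end of a window, the step size there, and the
    sum of [delta] over the window, which contains a time when agent 0 selects [l]. *)
Lemma limit_point_block_stationary xs l z : limit_point d B s xs -> (l < B)%nat -> K l z ->
  0 <= ipv d (gF xs l) (vsub z (xs l)) + r l z - r l (xs l).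
Proof.
  intros Hlim Hl Hz. apply Rnot_lt_le. intros Hneg.
  pose proof (limit_point_mem xs Hlim) as Hxs.
  destruct (step_lower_near_nonstationary xs l z Hxs Hl Hz Hneg)
    as (eps & del & T0 & Heps & Hdel & Hlow).
  destruct sbar_step_norm as (C & HC0 & HC).
  destruct (Hsel_cov 0%nat ltac:(lia)) as (T & HT & Hcov).
  (* A step size below [e2] limits the drift of the average within a window to [eps / 2], so the
     time of selection is within [eps] of [xs] when the end is within [eps / 2]. *)
  set (e2 := eps / (2 * (INR T * C + 1))).
  assert (HTC : 0 <= INR T * C) by (apply Rmult_le_pos; auto using pos_INR).
  assert (He2 : 0 < e2) by (apply Rdiv_lt_0_compat; lra).
  destruct (summable_sqr_lim0 gamma ltac:(intros t; pose proof (Hg_pos t); lra)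
              gamma_sqr_summable e2 He2) as [T1 HT1].
  destruct (summable_decrease_escape (fun t => normb d B (bsub (s (T + t)%nat) xs))
     (fun t => gamma (T + t)%nat) (fun t => rsum T (fun k => delta (k + t)%nat))
     C (del ^ 2) (eps / 2) (Nat.max T0 T1)) as [T2 HT2].
  - exact HC0.
  - apply pow_lt; exact Hdel.
  - lra.
  - intros t. pose proof (Hg_pos (T + t)%nat). lra.
  - intros t. apply rsum_nonneg; intros; apply delta_nonneg.
  - intros t. rewrite Nat.add_succ_r.
    pose proof (normb_sub_triang d B (s (S (T + t))) (s (T + t)%nat) xs).
    specialize (HC (T + t)%nat). lra.
  (* The step size at the end of the window is the smallest in it, so the product is dominated by
     [T] shifted copies of the summable [gamma * delta]. *)
  - apply summable_le with (fun t => rsum T (fun k => gamma (k + t)%nat * delta (k + t)%nat)).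
    + intros t. rewrite <- rsum_scal. apply rsum_le; intros k Hk.
      apply Rmult_le_compat_r; [apply delta_nonneg | apply gamma_le_of_le; lia].
    + apply (summable_rsum T (fun k t => gamma (k + t)%nat * delta (k + t)%nat)).
      intros k _. exact (summable_shift _ k gamma_delta_nonneg gamma_delta_summable).
  - apply gamma_shift_not_summable.
  - intros t Ht Hu. destruct (Hcov t l Hl) as (k & Hk & Hsel).
    assert (Hnear : normb d B (bsub (s (t + k)%nat) xs) < eps).
    { pose proof (normb_sub_triang d B (s (t + k)%nat) (s (T + t)%nat) xs) as H1.
      pose proof (sbar_drift C (t + k) (T - k) HC0 HC) as H2.
      replace (t + k + (T - k))%nat with (T + t)%nat in H2 by lia.
      rewrite normb_sub_sym in H2. specialize (HT1 (t + k)%nat ltac:(lia)).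
      assert (INR (T - k) * (C * gamma (t + k)%nat) <= eps / 2).
      { pose proof (Hg_pos (t + k)%nat).
        apply Rle_trans with (INR T * (C * gamma (t + k)%nat)).
        - apply Rmult_le_compat_r; [apply Rmult_le_pos; lra | apply le_INR; lia].
        - rewrite <- Rmult_assoc. apply Rle_trans with ((INR T * C + 1) * e2).
          + apply Rmult_le_compat; lra.
          + right. unfold e2. field. lra. }
      lra. }
    specialize (Hlow (t + k)%nat ltac:(lia) Hnear Hsel).
    apply Rle_trans with (delta (k + t)%nat).
    + rewrite Nat.add_comm. unfold delta. rewrite Hsel. apply pow_incr. lra.
    + apply (rsum_term_le T (fun k => delta (k + t)%nat)); [intros; apply delta_nonneg | exact Hk].
  (* The escape keeps the averages at distance at least [eps / 2 / 2] from [xs] eventually, which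
     contradicts its being a limit point. *)
  - destruct (Hlim (eps / 2 / 2) ltac:(lra) (T + T2)%nat) as (t & Ht & Hlt).
    specialize (HT2 (t - T)%nat ltac:(lia)). replace (T + (t - T))%nat with t in HT2 by lia. lra.
Qed.

Lemma limit_point_stationary xs : limit_point d B s xs -> stationary N d B K gf r xs.
Proof.
  intros Hlim. split; [now apply limit_point_mem|].
  intros z Hz. apply rsum_nonneg; intros l Hl.
  apply limit_point_block_stationary; auto.
Qed.

End Algorithm.

Theorem theorem1
  (N B d : nat)
  (K : nat -> vec -> Prop)
  (f : nat -> bvec -> R) (gf : nat -> bvec -> bvec) (Lf : nat -> R)
  (r : nat -> vec -> R)
  (E : nat -> nat -> Prop)
  (sel : nat -> nat -> nat)
  (A : nat -> nat -> nat -> nat -> R) (kappa : R)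
  (tf : nat -> nat -> vec -> bvec -> R) (gtf : nat -> nat -> vec -> bvec -> vec)
  (tau : nat -> R)
  (gamma : nat -> R)
  (x : nat -> nat -> bvec) (y : nat -> nat -> bvec) (phi : nat -> nat -> nat -> R)
  (xt : nat -> nat -> vec)
  (* dimensions *)
  (HN : (1 <= N)%nat) (HB : (1 <= B)%nat) (Hd : (1 <= d)%nat)
  (* problem assumptions *)
  (HK : forall l, (l < B)%nat ->
          (exists z, K l z) /\ closed_vset d (K l) /\ convex_vset (K l))
  (Hf_rel : forall i, (i < N)%nat -> forall u v, eqbv d B u v -> f i u = f i v)
  (Hf_C1 : forall i, (i < N)%nat -> C1_on_nbhd d B (inK B K) (f i) (gf i))
  (Hf_lip : forall i, (i < N)%nat -> lipschitz_on_b d B (inK B K) (gf i) (Lf i))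
  (Hf_bnd : forall i, (i < N)%nat -> bounded_on_b d B (inK B K) (gf i))
  (Hr_rel : forall l, (l < B)%nat -> forall u v, eqv d u v -> r l u = r l v)
  (Hr_cvx : forall l, (l < B)%nat -> convex_fun (r l))
  (Hr_sub : forall l, (l < B)%nat -> bounded_subgrad_on d (K l) (r l))
  (HU : coercive_on d B (inK B K) (Uobj N B f r))
  (* network *)
  (HE_loop : forall i, (i < N)%nat -> E i i)
  (HE_sc : strongly_connected N E)
  (* block selection *)
  (Hsel_rng : forall t i, (i < N)%nat -> (sel t i < B)%nat)
  (Hsel_cov : forall i, (i < N)%nat -> exists T, (0 < T)%nat /\
                forall t l, (l < B)%nat -> exists s, (s < T)%nat /\ sel (t + s)%nat i = l)
  (* weights *)
  (Hkappa : 0 < kappa)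
  (HA_pos : forall l t i j, (l < B)%nat -> (i < N)%nat -> (j < N)%nat ->
              in_Elt N E sel t i l j -> kappa < A l t i j)
  (HA_zero : forall l t i j, (l < B)%nat -> (i < N)%nat -> (j < N)%nat ->
               ~ in_Elt N E sel t i l j -> A l t i j = 0)
  (HA_col : forall l t j, (l < B)%nat -> (j < N)%nat -> rsum N (fun i => A l t i j) = 1)
  (* surrogates *)
  (Htf_rel : forall i l, (i < N)%nat -> (l < B)%nat ->
               forall z z' w w', eqv d z z' -> eqbv d B w w' -> tf i l z w = tf i l z' w')
  (Htau : forall i, (i < N)%nat -> 0 < tau i)
  (Htf_sc : forall i l, (i < N)%nat -> (l < B)%nat -> forall w, inK B K w ->
              strongly_convex_on d (K l) (fun z => tf i l z w) (tau i))
  (Htf_grad : forall i l, (i < N)%nat -> (l < B)%nat -> forall w, inK B K w ->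
              forall z, K l z -> has_grad_v d (fun z => tf i l z w) (gtf i l z w) z)
  (Htf_cont : forall i l, (i < N)%nat -> (l < B)%nat -> forall w, inK B K w ->
              cont_on_v d (K l) (fun z => gtf i l z w))
  (Htf_cons : forall i l, (i < N)%nat -> (l < B)%nat -> forall w, inK B K w ->
              eqv d (gtf i l (w l) w) (gf i w l))
  (Htf_lip : forall i l, (i < N)%nat -> (l < B)%nat -> exists L, forall z, K l z ->
              forall w w', inK B K w -> inK B K w' ->
                normv d (vsub (gtf i l z w) (gtf i l z w')) <= L * normb d B (bsub w w'))
  (* step sizes *)
  (Hg_pos : forall t, 0 < gamma t <= 1)
  (Hg_dec : forall t, gamma (S t) <= gamma t)
  (Hg_div : cv_infty (fun T => sum_f_R0 gamma T))
  (Hg_sq : exists s, infinite_sum (fun t => (gamma t)^2) s)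
  (* initialization *)
  (Hx0 : forall i, (i < N)%nat -> inK B K (x 0%nat i))
  (Hy0 : forall i, (i < N)%nat -> eqbv d B (y 0%nat i) (gf i (x 0%nat i)))
  (Hphi0 : forall i l, (i < N)%nat -> (l < B)%nat -> phi 0%nat i l = 1)
  (* local subproblem *)
  (Hxt : forall t i, (i < N)%nat ->
           K (sel t i) (xt t i) /\
           forall z, K (sel t i) z ->
             hatf N d (tf i (sel t i)) (gf i) (sel t i) (xt t i) (x t i) (y t i (sel t i))
               + r (sel t i) (xt t i)
             <= hatf N d (tf i (sel t i)) (gf i) (sel t i) z (x t i) (y t i (sel t i))
               + r (sel t i) z)
  (* updates *)
  (Hphi : forall t i l, (i < N)%nat -> (l < B)%nat ->
            phi (S t) i l = rsum N (fun j => A l t i j * phi t j l))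
  (Hx : forall t i l k, (i < N)%nat -> (l < B)%nat -> (k < d)%nat ->
          x (S t) i l k =
          rsum N (fun j => A l t i j * phi t j l / phi (S t) i l
                           * (x t j l k + gamma t * dx x xt sel t j l k)))
  (Hy : forall t i l k, (i < N)%nat -> (l < B)%nat -> (k < d)%nat ->
          y (S t) i l k =
          rsum N (fun j => A l t i j / phi (S t) i l
                           * (phi t j l * y t j l k
                              + gf j (x (S t) j) l k - gf j (x t j) l k)))
  : (forall i, (i < N)%nat ->
       Un_cv (fun t => normb d B (bsub (x t i) (sbar N phi x t))) 0)
    /\ (exists M, forall t, normb d B (sbar N phi x t) <= M)
    /\ (forall xs, limit_point d B (sbar N phi x) xs -> stationary N d B K gf r xs).
Proof.
  split; [|split].
  - intros i Hi. eapply consensus; eassumption.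
  - eapply sbar_bounded; eassumption.
  - intros xs Hxs. eapply limit_point_stationary; eassumption.
Qed.
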